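(* Let $N\ge 3$, $p>p_S$, $\nu>0$ and $pC_{p,\nu}^{p-1}>\nu^2$. Let $U_*>0$ be a subsolution of $$-\Delta u+\frac{\nu^2-\nu_*^2}{|x|^2}u=u^p\quad\text{in }\mathbb{R}^N\setminus K$$ such that $$\liminf_{|x|\to\infty}\frac{U_*(x)}{|x|^{-\frac{2}{p-1}}}\ge C_{p,\nu}.$$ Then $U_*$ is unstable. Further, if $u>0$ is a supersolution of the same equation, then either $u=U_*$, or $(u-U_* )_-\neq 0$ in $\mathbb{R}^N\setminus\bar B_R$ for arbitrarily large $R>0$.
   Context: Notation: $\nu_*:=\frac{N-2}{2}$; $p_S:=\frac{N+2}{N-2}$; $C_{p,\nu}>0$ is defined by $C_{p,\nu}^{p-1}:=\nu^2-\left(\nu_*-\frac{2}{p-1}\right)^2$ (positive under the stated hypotheses). $K$ is either $\{0\}$ or a connected compact set with smooth boundary containing $0$. $B_R$ is the ball of radius $R$ centred at $0$, and $f_-$ denotes the negative part of $f$; $(u-U_* )_-\neq0$ means that this function is not identically zero. Sub- and supersolutions are classical: $u\in C^2(\mathbb{R}^N\setminus K)$ is a subsolution (supersolution) if $-\Delta u+\frac{\nu^2-\nu_*^2}{|x|^2}u\le u^p$ (respectively $\ge u^p$) pointwise in $\mathbb{R}^N\setminus K$. Stability: a positive function $u$ on $\mathbb{R}^N\setminus K$ is stable in an open set $\Omega\subset\mathbb{R}^N\setminus K$ if $$\int|\nabla\varphi|^2\,dx+(\nu^2-\nu_*^2)\int\frac{\varphi^2}{|x|^2}\,dx-p\int u^{p-1}\varphi^2\,dx\ge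 0\qquad\forall\varphi\in C_c^\infty(\Omega).$$ It is semi-stable if it is stable in $\mathbb{R}^N\setminus\bar B_R$ for some $R>0$ with $K\subset\bar B_R$, and unstable if it is not semi-stable.
   Formalization: The alternative ''u = U_*'' is taken in the exterior of the closed ball B_R, for every R > 0 with K inside that ball, not on all of R^N \ K: a supersolution can differ from U_* only inside an annulus, so the literal dichotomy fails. *)

(* Defs.v *)
From HB Require Import structures.
From mathcomp Require Import all_boot all_order all_algebra.
From mathcomp Require Import all_classical all_reals all_analysis.

Set Implicit Arguments.
Unset Strict Implicit.
Unset Printing Implicit Defensive.

Import Order.TTheory GRing.Theory Num.Theory.
Import numFieldNormedType.Exports.

Local Open Scope classical_set_scope.
Local Open Scope ring_scope.

(* The library norm on 'rV[R]_N is the sup norm; it induces the right topology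
   but not the right balls. *)
Definition enorm (R : realType) (N : nat) (x : 'rV[R]_N) : R :=
  Num.sqrt (\sum_(i < N) x ord0 i ^+ 2).

Definition ecball (R : realType) (N : nat) (r : R) : set 'rV[R]_N :=
  [set x | enorm x <= r].
Arguments ecball {R} N r.

Definition enorm_infty (R : realType) (N : nat) : set_system 'rV[R]_N :=
  [set A : set 'rV[R]_N | \forall r \near +oo, forall x, r < enorm x -> A x].
Arguments enorm_infty R N : clear implicits.

Definition partial (R : realType) (N : nat) (i : 'I_N) (f : 'rV[R]_N -> R) :
    'rV[R]_N -> R :=
  fun x => 'D_(delta_mx ord0 i) f x.

Definition laplacian (R : realType) (N : nat) (f : 'rV[R]_N -> R)
    (x : 'rV[R]_N) : R :=
  \sum_(i < N) partial i (partial i f) x.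

Definition grad_sqr (R : realType) (N : nat) (f : 'rV[R]_N -> R)
    (x : 'rV[R]_N) : R :=
  \sum_(i < N) partial i f x ^+ 2.

(* Only meaningful when A is open. *)
Fixpoint Ck (R : realType) (N : nat) (k : nat) (A : set 'rV[R]_N)
    (f : 'rV[R]_N -> R) : Prop :=
  (forall x, A x -> {for x, continuous f}) /\
  if k is k'.+1 then
    forall i : 'I_N,
      (forall x, A x -> derivable f x (delta_mx ord0 i)) /\
      Ck k' A (partial i f)
  else True.

Definition smooth (R : realType) (N : nat) (A : set 'rV[R]_N)
    (f : 'rV[R]_N -> R) : Prop :=
  forall k, Ck k A f.

Definition test_function (R : realType) (N : nat) (A : set 'rV[R]_N)
    (phi : 'rV[R]_N -> R) : Prop :=
  let supp := closure [set x | phi x != 0] in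
  [/\ smooth setT phi, compact supp & supp `<=` A].

(* For a closed set K: near each point of K `\` K° (the topological boundary),
   K is a smooth domain lying on one side of its boundary. *)
Definition smooth_boundary (R : realType) (N : nat) (K : set 'rV[R]_N) : Prop :=
  forall x, (K `\` K°) x ->
    exists (V : set 'rV[R]_N) (rho : 'rV[R]_N -> R),
      [/\ open V, V x, smooth V rho, (exists i, partial i rho x != 0) &
          K `&` V = [set y | rho y <= 0] `&` V].

Definition admissible_core (R : realType) (N : nat) (K : set 'rV[R]_N) : Prop :=
  K = [set 0] \/ [/\ compact K, connected K, K 0 & smooth_boundary K].

Definition cons_prod (R : realType) (n : nat)
    (z : measurableTypeR R * n.-tuple (measurableTypeR R)) :
    n.+1.-tuple (measurableTypeR R) :=
  [tuple of z.1 :: z.2].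

Lemma measurable_cons_prod (R : realType) (n : nat) :
  measurable_fun [set: measurableTypeR R * n.-tuple (measurableTypeR R)]
    (@cons_prod R n).
Proof. exact: measurable_cons. Qed.

Definition lebesgue_cons (R : realType) (n : nat)
    (mu : {sigma_finite_measure set (n.-tuple (measurableTypeR R)) -> \bar R}) :
    set (n.+1.-tuple (measurableTypeR R)) -> \bar R :=
  pushforward (@lebesgue_measure R \x mu)%E (@cons_prod R n).

HB.instance Definition _ (R : realType) (n : nat)
    (mu : {sigma_finite_measure set (n.-tuple (measurableTypeR R)) -> \bar R}) :=
  Measure.copy (lebesgue_cons mu)
    (measure_function_pushforward__canonical__measure_function_Measure
       (@lebesgue_measure R \x mu)%E (@measurable_cons_prod R n)).

Lemma sigma_finite_lebesgue_cons (R : realType) (n : nat)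
    (mu : {sigma_finite_measure set (n.-tuple (measurableTypeR R)) -> \bar R}) :
  sigma_finite setT (lebesgue_cons mu).
Proof.
have [F FT mF] : sigma_finite setT (@lebesgue_measure R \x mu)%E.
  have /sigma_finiteP[F [TF ndF Foo]] := sigma_finiteT (@lebesgue_measure R).
  have /sigma_finiteP[G [TG ndG Goo]] := sigma_finiteT mu.
  exists (fun n => F n `*` G n).
    rewrite -setXTT TF TG predeqE => -[x y]; split.
      move=> [/= [i _ Fix] [k _ Gky]]; exists (maxn i k) => //; split.
      - by move: x Fix; exact/subsetPset/ndF/leq_maxl.
      - by move: y Gky; exact/subsetPset/ndG/leq_maxr.
    by move=> [i _ []/= ? ?]; split; exists i.
  move=> k; have [? ?] := Foo k; have [? ?] := Goo k.
  split; first exact: measurableX.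
  by rewrite product_measure1E// lte_mul_pinfty// ge0_fin_numE.
pose uncons (t : n.+1.-tuple (measurableTypeR R)) :
    measurableTypeR R * n.-tuple (measurableTypeR R) :=
  (tnth t ord0, [tuple of behead t]).
have muncons : measurable_fun setT uncons.
  apply/measurable_fun_pair; first exact: measurable_tnth.
  exact: measurable_behead.
have unconsK z : uncons (cons_prod z) = z.
  by case: z => x t; congr pair; exact/val_inj.
exists (fun k => uncons @^-1` F k).
  by rewrite -preimage_bigcup -FT preimage_setT.
move=> k; have [mFk Fk] := mF k; split.
  by rewrite -[X in measurable X]setTI; exact: muncons.
rewrite /lebesgue_cons /pushforward (_ : _ @^-1` _ = F k)//.
by rewrite -comp_preimage; apply/seteqP; split => z /=; rewrite unconsK.
Qed.

HB.instance Definition _ (R : realType) (n : nat)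
    (mu : {sigma_finite_measure set (n.-tuple (measurableTypeR R)) -> \bar R}) :=
  Measure_isSigmaFinite.Build _ _ _ (lebesgue_cons mu)
    (sigma_finite_lebesgue_cons mu).

Fixpoint lebesgue_tuple (R : realType) (n : nat) :
    {sigma_finite_measure set (n.-tuple (measurableTypeR R)) -> \bar R} :=
  match n with
  | 0 => dirac [tuple]
  | n'.+1 => lebesgue_cons (lebesgue_tuple R n')
  end.
Arguments lebesgue_tuple R n : clear implicits.

Lemma lebesgue_tuple_box (R : realType) (n : nat)
    (A : 'I_n -> set (measurableTypeR R)) :
  (forall i, measurable (A i)) ->
  lebesgue_tuple R n [set t | forall i, A i (tnth t i)] =
  (\prod_(i < n) lebesgue_measure (A i))%E.
Proof.
elim: n A => [|n IHn] A mA /=.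
  rewrite big_ord0 diracE mem_set//= => -[] //.
rewrite big_ord_recl -IHn; last by move=> i; exact: mA.
rewrite /lebesgue_cons /pushforward.
pose B := [set t : n.-tuple (measurableTypeR R) |
            forall i, A (lift ord0 i) (tnth t i)].
have mB : measurable B.
  have -> : B = \bigcap_(i in [set: 'I_n]) ((@tnth _ _)^~ i @^-1` A (lift ord0 i)).
    by apply/seteqP; split => [t Bt i _|t Bt i]; exact: Bt.
  apply: fin_bigcap_measurable => // i _.
  by rewrite -[X in measurable X]setTI; exact: measurable_tnth.
rewrite (_ : _ @^-1` _ = A ord0 `*` B); first exact: product_measure1E.
apply/seteqP; split => -[x t] /=.
  move=> h; split; first exact: (h ord0).
  by move=> i; have := h (lift ord0 i); rewrite tnthS.
move=> [Ax Bt] i; have [->//|i0] := eqVneq i ord0.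
have [j ->] : exists j, i = lift ord0 j.
  by have := neq_lift; case: (unliftP ord0 i) i0 => [j ->|->]; [exists j|rewrite eqxx].
by rewrite tnthS; exact: Bt.
Qed.

Definition integral_rV (R : realType) (N : nat) (f : 'rV[R]_N -> R) : R :=
  (\int[lebesgue_tuple R N]_t f (\row_(i < N) tnth t i))%R.

Definition nu_star (R : realType) (N : nat) : R := (N%:R - 2) / 2.
Arguments nu_star R N : clear implicits.

Definition p_S (R : realType) (N : nat) : R := (N%:R + 2) / (N%:R - 2).
Arguments p_S R N : clear implicits.

Definition hardy_op (R : realType) (N : nat) (nu : R) (u : 'rV[R]_N -> R)
    (x : 'rV[R]_N) : R :=
  - laplacian u x + (nu ^+ 2 - nu_star R N ^+ 2) / enorm x ^+ 2 * u x.

Definition subsolution (R : realType) (N : nat) (p nu : R) (K : set 'rV[R]_N)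
    (u : 'rV[R]_N -> R) : Prop :=
  Ck 2 (~` K) u /\ forall x, ~ K x -> hardy_op nu u x <= u x `^ p.

Definition supersolution (R : realType) (N : nat) (p nu : R) (K : set 'rV[R]_N)
    (u : 'rV[R]_N -> R) : Prop :=
  Ck 2 (~` K) u /\ forall x, ~ K x -> hardy_op nu u x >= u x `^ p.

(* The integrals run over the whole space, but phi vanishes off A, hence off K,
   where u is unconstrained, and at the origin. *)
Definition stable (R : realType) (N : nat) (p nu : R) (u : 'rV[R]_N -> R)
    (A : set 'rV[R]_N) : Prop :=
  forall phi : 'rV[R]_N -> R, test_function A phi ->
    0 <= integral_rV (grad_sqr phi)
       + (nu ^+ 2 - nu_star R N ^+ 2)
         * integral_rV (fun x => phi x ^+ 2 / enorm x ^+ 2)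
       - p * integral_rV (fun x => u x `^ (p - 1) * phi x ^+ 2).

Definition semi_stable (R : realType) (N : nat) (p nu : R) (K : set 'rV[R]_N)
    (u : 'rV[R]_N -> R) : Prop :=
  exists r : R,
    [/\ 0 < r, K `<=` ecball N r & stable p nu u (~` ecball N r)].

Definition unstable (R : realType) (N : nat) (p nu : R) (K : set 'rV[R]_N)
    (u : 'rV[R]_N -> R) : Prop :=
  ~ semi_stable p nu K u.

(* Main.v *)
(* Far out the potential V = p U^(p-1) - (nu^2 - nu_star^2)/|x|^2 is at least
   (nu_star^2 + delta)/|x|^2, which exceeds the optimal Hardy constant. Hence
   there is a smooth phi >= 0 supported in a large shell with
   Laplacian phi + V phi > 0 pointwise wherever phi > 0, namely
   phi = |x|^(- nu_star) chi (ln |x|^2) with chi a very wide bump.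
   Integrating phi (Laplacian phi + V phi) by parts gives a negative quadratic
   form, so U is unstable. If u >= U outside a ball then w = u - U >= 0
   satisfies Laplacian w + V w <= 0 by convexity of t^p, so w vanishes
   identically or is positive by the strong maximum principle; in the second
   case, the smallest multiple of w above phi touches phi at a point where the
   two differential inequalities contradict each other. *)
Require Import Defs.
From HB Require Import structures.
From mathcomp Require Import all_boot all_order all_algebra.
From mathcomp Require Import all_classical all_reals all_analysis.
From mathcomp Require Import measurable_realfun ring lra.

Set Implicit Arguments.
Unset Strict Implicit.
Unset Printing Implicit Defensive.

Import Order.TTheory GRing.Theory Num.Theory.
Import numFieldNormedType.Exports.

Local Open Scope classical_set_scope.
Local Open Scope ring_scope.

(** * Calculus of C^k functions *)

Section DirectionalDerivatives.
Context {R : realType} {V : normedModType R}.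
Implicit Types (f : V -> R) (g : R -> R) (x v : V).

(** A first Dirichlet eigenfunction of the linearised operator on a shell could drive both halves,
    but it would need spectral theory and is not smooth when extended by 0. The explicit [phi] is
    smooth across the edge of its support, so it is itself a test function. The price is a bound
    chi'' >= - C chi up to that edge, where chi tends to 0; an arbitrary bump need not satisfy it,
    but exp (- 1 / w) does, being convex near the zeros of w. Stretching the bump over a length lam
    divides C by lam^2, which brings the loss below the fixed gap delta. That gap comes from the
    strict inequality p C^(p-1) > nu^2. The obstacle in the maximum principle is that nothing bounds
    V from above. Since w >= 0, only a lower bound V >= - M is required, and it yields Laplacian w
    <= M w outside the ball. Positivity then spreads through one ball by a barrier, and through the
    exterior by chains of balls of a common radius. *)

Lemma is_derive_lineP f x v d :
  is_derive x v f d <-> is_derive (0 : R) 1 (fun h : R => f (h *: v + x)) d.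
Proof.
have E : (fun h : R => h^-1 *: ((f \o shift x) (h *: v) - f x)) =
  (fun h : R => h^-1 *: (((fun h : R => f (h *: v + x)) \o shift 0) (h *: 1) -
     f ((0 : R) *: v + x))).
  by apply/funext => h /=; rewrite addr0 scale0r add0r [_%:A]mulr1.
split=> -[dv dl].
  apply: DeriveDef; first by apply/(derivable1P f x v).
  by rewrite -dl /derive E.
apply: DeriveDef; first by apply/(derivable1P f x v).
by rewrite -dl /derive E.
Qed.

(** Restriction to the line through x in direction v reduces this to the one-variable chain rule.
    Only a derivative in the direction v is asked of f, which is what [Ck] supplies. *)
Lemma is_derive_comp_real f g x v df dg :
  is_derive x v f df -> is_derive (f x) (1 : R) g dg ->
  is_derive x v (g \o f) (dg * df).
Proof.
move=> /is_derive_lineP hf hg; apply/is_derive_lineP.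
have := @is_derive1_comp R g (fun h : R => f (h *: v + x)) 0 dg df _ hf.
by rewrite /= scale0r add0r; apply.
Qed.

End DirectionalDerivatives.

Lemma is_derive_line_at {R : realType} {V : normedModType R} (f : V -> R) (x v : V) (h d : R) :
  is_derive (h *: v + x) v f d ->
  is_derive h (1 : R) (fun h : R => f (h *: v + x)) d.
Proof.
move=> /is_derive_lineP H; apply/(@is_derive_lineP R R^o).
have -> : (fun h0 : R => f ((h0 *: 1 + h) *: v + x)) =
          (fun h0 : R => f (h0 *: v + (h *: v + x))); last exact: H.
by apply/funext => k; rewrite [k%:A]mulr1 scalerDl addrA.
Qed.


Section SmoothFunctions.
Context {R : realType} {N : nat}.
Implicit Types (f g : 'rV[R]_N -> R) (A B : set 'rV[R]_N) (x : 'rV[R]_N).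
Local Notation e i := (delta_mx ord0 i : 'rV[R]_N).

Lemma is_derive_partial f i x d : is_derive x (e i) f d -> partial i f x = d.
Proof. by move=> [_ <-]. Qed.

Lemma Ck_continuous k A f x : Ck k A f -> A x -> {for x, continuous f}.
Proof. by case: k => [|k] [+ _]; apply. Qed.

Lemma CkS_is_derive k A f x i : Ck k.+1 A f -> A x ->
  is_derive x (e i) f (partial i f x).
Proof. by move=> [_ /(_ i) [h _]] /h /derivableP. Qed.

Lemma CkS_partial k A f i : Ck k.+1 A f -> Ck k A (partial i f).
Proof. by move=> [_ /(_ i) []]. Qed.

Lemma CkW k A f : Ck k.+1 A f -> Ck k A f.
Proof.
elim: k f => [|k IH] f [cf df]; first by split.
by split=> // i; have [dfi Ci] := df i; split=> //; exact: IH.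
Qed.

Lemma Ck_sub k A B f : B `<=` A -> Ck k A f -> Ck k B f.
Proof.
elim: k f => [|k IH] f BA [cf df]; split => //; try by move=> x /BA; exact: cf.
move=> i; have [dfi Ci] := df i; split; last exact: IH.
by move=> x /BA; exact: dfi.
Qed.

Lemma CkU k A B f : Ck k A f -> Ck k B f -> Ck k (A `|` B) f.
Proof.
elim: k f => [|k IH] f [cA dA] [cB dB]; split => //; try by move=> x []; [exact: cA|exact: cB].
move=> i; have [dAi CAi] := dA i; have [dBi CBi] := dB i; split; last exact: IH.
by move=> x []; [exact: dAi|exact: dBi].
Qed.

Lemma partial_eq A f g x i : open A -> {in A, f =1 g} -> A x ->
  partial i f x = partial i g x.
Proof.
move=> oA fg Ax; apply: near_eq_derive.
have : nbhs x A by exact: open_nbhs_nbhs.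
by apply: filterS => y Ay; apply: fg; rewrite inE.
Qed.

Lemma for_continuous_eq A f g x : open A -> {in A, f =1 g} -> A x ->
  {for x, continuous f} -> {for x, continuous g}.
Proof.
move=> oA fg Ax cf; have nA : nbhs x A by exact: open_nbhs_nbhs.
have E : \forall y \near x, f y = g y.
  by apply: filterS nA => y Ay; apply: fg; rewrite inE.
rewrite /prop_for /continuous_at -fg ?inE//; apply: cvg_trans cf.
exact: (near_eq_cvg E).
Qed.

Lemma Ck_eq k A f g : open A -> {in A, f =1 g} -> Ck k A f -> Ck k A g.
Proof.
move=> oA; elim: k f g => [|k IH] f g fg [cf df].
  by split => // x Ax; exact: (for_continuous_eq oA fg Ax (cf x Ax)).
split.
  by move=> x Ax; exact: (for_continuous_eq oA fg Ax (cf x Ax)).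
move=> i; have [dfi Ci] := df i; split.
  move=> x Ax; apply: near_eq_derivable (dfi _ Ax).
  have nA : nbhs x A by exact: open_nbhs_nbhs.
  by apply: filterS nA => y Ay; apply: fg; rewrite inE.
apply: IH Ci => x; rewrite inE => Ax; exact: (partial_eq i oA fg Ax).
Qed.

Lemma Ck_cst k A (c : R) : Ck k A (cst c : 'rV[R]_N -> R).
Proof.
elim: k c => [|k IH] c; first by split => // x _; apply: cst_continuous.
split=> [x _|i]; first by apply: cst_continuous.
split; first by move=> x _; exact: derivable_cst.
have -> : partial i (cst c : 'rV[R]_N -> R) = cst 0; last exact: IH.
by apply/funext => x; exact: derive_cst.
Qed.

Lemma CkD k A f g : open A -> Ck k A f -> Ck k A g -> Ck k A (f \+ g).
Proof.
move=> oA; elim: k f g => [|k IH] f g Cf Cg.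
  by split => // x Ax; apply: continuousD; [exact: (Ck_continuous Cf Ax)|exact: (Ck_continuous Cg Ax)].
split.
  by move=> x Ax; apply: continuousD; [exact: (Ck_continuous Cf Ax)|exact: (Ck_continuous Cg Ax)].
move=> i; have D x : A x -> is_derive x (e i) (f \+ g) (partial i f x + partial i g x).
  by move=> Ax; apply: is_deriveD; [exact: CkS_is_derive Cf Ax|exact: CkS_is_derive Cg Ax].
split; first by move=> x /D [].
apply: (@Ck_eq k A (partial i f \+ partial i g)) => //.
  by move=> x; rewrite inE => /D /is_derive_partial ->.
by apply: IH; apply: CkS_partial.
Qed.

Lemma CkM k A f g : open A -> Ck k A f -> Ck k A g -> Ck k A (f \* g).
Proof.
move=> oA; elim: k f g => [|k IH] f g Cf Cg.
  by split => // x Ax; apply: continuousM; [exact: (Ck_continuous Cf Ax)|exact: (Ck_continuous Cg Ax)].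
split.
  by move=> x Ax; apply: continuousM; [exact: (Ck_continuous Cf Ax)|exact: (Ck_continuous Cg Ax)].
move=> i; have D x : A x -> is_derive x (e i) (f \* g)
    (f x * partial i g x + g x * partial i f x).
  by move=> Ax; apply: is_deriveM; [exact: CkS_is_derive Cf Ax|exact: CkS_is_derive Cg Ax].
split; first by move=> x /D [].
apply: (@Ck_eq k A ((f \* partial i g) \+ (g \* partial i f))) => //.
  by move=> x; rewrite inE => /D /is_derive_partial ->.
by apply: CkD => //; apply: IH; [exact: CkW|exact: CkS_partial|exact: CkW|exact: CkS_partial].
Qed.

Lemma CkZ k A f (c : R) : open A -> Ck k A f -> Ck k A (fun x => c * f x).
Proof. by move=> oA Cf; apply: (@CkM k A (cst c)) => //; exact: Ck_cst. Qed.

Lemma CkB k A f g : open A -> Ck k A f -> Ck k A g -> Ck k A (f \- g).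
Proof.
move=> oA Cf Cg; apply: (@Ck_eq k A (f \+ (fun x => -1 * g x))) => //.
  by move=> x _ /=; rewrite mulN1r.
by apply: CkD => //; exact: CkZ.
Qed.

(** [G] lists an outer function with all its derivatives. Differentiating [G j \o f] yields
    [G j.+1 \o f] times a partial derivative of f, so the induction on k must leave j free. *)
Lemma Ck_comp k A f (G : nat -> R -> R) (B : set R) j : open A ->
  (forall l y, B y -> is_derive y (1 : R) (G l) (G l.+1 y)) ->
  (forall x, A x -> B (f x)) -> Ck k A f -> Ck k A (G j \o f).
Proof.
move=> oA dG fB; elim: k j => [|k IH] j Cf.
all: have cont x : A x -> {for x, continuous (G j \o f)}.
1,3: move=> Ax; apply: continuous_comp; first exact: Ck_continuous Cf Ax.
1,2: by apply: differentiable_continuous; apply/derivable1_diffP; case: (dG j _ (fB _ Ax)).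
  by split.
split => // i.
have D x : A x -> is_derive x (e i) (G j \o f) (G j.+1 (f x) * partial i f x).
  move=> Ax; apply: is_derive_comp_real; first exact: CkS_is_derive Cf Ax.
  exact/dG/fB.
split; first by move=> x /D [].
apply: (@Ck_eq k A ((G j.+1 \o f) \* partial i f)) => //.
  by move=> x; rewrite inE => /D /is_derive_partial ->.
by apply: CkM => //; [exact/IH/CkW|exact: CkS_partial].
Qed.

Lemma is_derive_coord i j x :
  is_derive x (e i) (fun y : 'rV[R]_N => y ord0 j) (i == j)%:R.
Proof.
apply/is_derive_lineP.
have -> : (fun h : R => (h *: e i + x) ord0 j) =
          (fun h : R => (i == j)%:R *: h) \+ cst (x ord0 j).
  by apply/funext => h; rewrite !mxE eqxx/= eq_sym mulrC.
have D : is_derive (0 : R) (1 : R) (fun h : R => (i == j)%:R *: h) ((i == j)%:R *: 1).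
  exact: (is_deriveZ _ (is_derive_id _ _)).
apply: (is_derive_eq (is_deriveD D (is_derive_cst (x ord0 j) (0 : R) (1 : R)))).
by rewrite addr0 [_%:A]mulr1.
Qed.

Lemma Ck_coord k A i : open A -> Ck k A (fun y : 'rV[R]_N => y ord0 i).
Proof.
case: k => [|k] oA; first by split => // x _; exact: coord_continuous.
split; first by move=> x _; exact: coord_continuous.
move=> j; split; first by move=> x _; case: (is_derive_coord j i x).
apply: (@Ck_eq k A (cst (j == i)%:R)) => //; last exact: Ck_cst.
by move=> x _; rewrite (is_derive_partial (is_derive_coord j i x)).
Qed.

End SmoothFunctions.

(** * Squared distance and the Laplacian of radial functions *)

Section Distance.
Context {R : realType} {N : nat}.
Implicit Types (f g : 'rV[R]_N -> R) (A B : set 'rV[R]_N) (x : 'rV[R]_N).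
Local Notation e i := (delta_mx ord0 i : 'rV[R]_N).

Lemma Ck_sum k A n (F : 'I_n -> 'rV[R]_N -> R) : open A ->
  (forall i, Ck k A (F i)) -> Ck k A (fun x => \sum_(i < n) F i x).
Proof.
move=> oA; elim: n F => [|n IH] F CF.
  apply: (@Ck_eq _ _ k A (cst 0)) => //; last exact: Ck_cst.
  by move=> x _ ; rewrite big_ord0.
apply: (@Ck_eq _ _ k A ((fun x => \sum_(i < n) F (widen_ord (leqnSn n) i) x) \+ F ord_max)) => //.
  by move=> x _; rewrite big_ord_recr.
by apply: CkD => //; apply: IH => i; exact: CF.
Qed.

(** The square is a polynomial in the coordinates, hence smooth at z as well, unlike the Euclidean
    distance. *)
Definition sqdist (z x : 'rV[R]_N) : R := \sum_(i < N) (x ord0 i - z ord0 i) ^+ 2.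

Lemma sqdist_ge0 z x : 0 <= sqdist z x.
Proof. by apply: sumr_ge0 => i _; exact: sqr_ge0. Qed.

Lemma Ck_sqdist k A z : open A -> Ck k A (sqdist z).
Proof.
move=> oA; apply: Ck_sum => // i.
have C1 : Ck k A (fun x : 'rV[R]_N => x ord0 i - z ord0 i).
  by apply: (@CkB _ _ k A _ (cst _)) => //; [exact: Ck_coord|exact: Ck_cst].
exact: CkM.
Qed.

Lemma continuous_sqdist z : continuous (sqdist z).
Proof.
by move=> x; apply: (@Ck_continuous _ _ 0 setT) => //; apply: Ck_sqdist; exact: openT.
Qed.

Lemma is_derive_coord_sub i j (c : R) x :
  is_derive x (e i) (fun y : 'rV[R]_N => y ord0 j - c) (i == j)%:R.
Proof.
have D := is_deriveB (is_derive_coord i j x) (is_derive_cst c x (e i)).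
by rewrite subr0 in D.
Qed.

Lemma is_derive_sqdist z i x :
  is_derive x (e i) (sqdist z) (2 * (x ord0 i - z ord0 i)).
Proof.
have -> : sqdist z = \sum_(j < N) (fun x : 'rV[R]_N => (x ord0 j - z ord0 j) ^+ 2).
  by apply/funext => y; rewrite fct_sumE.
have D j : is_derive x (e i) (fun x : 'rV[R]_N => (x ord0 j - z ord0 j) ^+ 2)
   ((2 * (x ord0 j - z ord0 j)) * (i == j)%:R).
  have D1 : is_derive x (e i) (fun x : 'rV[R]_N => x ord0 j - z ord0 j) (i == j)%:R.
    exact: is_derive_coord_sub.
  apply: (is_derive_eq (is_deriveX 2 D1)).
  by rewrite expr1.
apply: (is_derive_eq (is_derive_sum D)).
rewrite (bigD1 i)//= eqxx mulr1 big1 ?addr0// => j ji.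
by rewrite eq_sym (negbTE ji) mulr0.
Qed.

Lemma laplacianD A f g x : open A -> Ck 2 A f -> Ck 2 A g -> A x ->
  laplacian (f \+ g) x = laplacian f x + laplacian g x.
Proof.
move=> oA Cf Cg Ax; rewrite /laplacian -big_split/=; apply: eq_bigr => i _.
rewrite (@partial_eq _ _ A _ (partial i f \+ partial i g))//.
  apply: is_derive_partial.
  by apply: is_deriveD; [exact: (CkS_is_derive i (CkS_partial i Cf) Ax)|exact: (CkS_is_derive i (CkS_partial i Cg) Ax)].
move=> y; rewrite inE => Ay; apply: is_derive_partial.
by apply: is_deriveD; [exact: (CkS_is_derive i Cf Ay)|exact: (CkS_is_derive i Cg Ay)].
Qed.

Lemma laplacianZ A f (c : R) x : open A -> Ck 2 A f -> A x ->
  laplacian (fun y => c * f y) x = c * laplacian f x.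
Proof.
move=> oA Cf Ax; rewrite /laplacian mulr_sumr; apply: eq_bigr => i _.
rewrite (@partial_eq _ _ A _ (fun y => c * partial i f y))//.
  by apply: is_derive_partial; exact: (is_deriveZ c (CkS_is_derive i (CkS_partial i Cf) Ax)).
move=> y; rewrite inE => Ay; apply: is_derive_partial.
exact: (is_deriveZ c (CkS_is_derive i Cf Ay)).
Qed.

Lemma laplacian_linear A f g (c d : R) x : open A -> Ck 2 A f -> Ck 2 A g -> A x ->
  laplacian (fun y => c * f y + d * g y) x = c * laplacian f x + d * laplacian g x.
Proof.
move=> oA Cf Cg Ax; rewrite -(laplacianZ c oA Cf Ax) -(laplacianZ d oA Cg Ax).
exact: (laplacianD oA (CkZ c oA Cf) (CkZ d oA Cg) Ax).
Qed.

(** With s = |x - z|^2, each partial derivative is 2 (x_i - z_i) F'(s). Differentiating again and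
    summing over i gives 4 s F'' + 2 N F'. *)
Lemma laplacian_radial (B : set R) (F F1 : R -> R) (F2 : R) z x : open B ->
  (forall s, B s -> is_derive s (1 : R) F (F1 s)) -> B (sqdist z x) ->
  is_derive (sqdist z x) (1 : R) F1 F2 ->
  laplacian (F \o sqdist z) x = 4 * sqdist z x * F2 + 2 * N%:R * F1 (sqdist z x).
Proof.
move=> oB dF Bx dF1.
have oA : open (sqdist z @^-1` B) by move/continuousP : (@continuous_sqdist z); exact.
rewrite /laplacian (eq_bigr (fun i => F2 * 4 * (x ord0 i - z ord0 i) ^+ 2 + 2 * F1 (sqdist z x))).
  rewrite big_split/= -mulr_sumr -/(sqdist z x) sumr_const card_ord -mulr_natr; ring.
move=> i _.
rewrite (@partial_eq _ _ (sqdist z @^-1` B) _ ((F1 \o sqdist z) \* (fun y => 2 * (y ord0 i - z ord0 i))))//.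
  apply: is_derive_partial.
  have D1 : is_derive x (e i) (F1 \o sqdist z) (F2 * (2 * (x ord0 i - z ord0 i))).
    by apply: is_derive_comp_real => //; exact: is_derive_sqdist.
  have D2 : is_derive x (e i) (fun x : 'rV[R]_N => 2 * (x ord0 i - z ord0 i)) 2.
    apply: (is_derive_eq (is_deriveZ 2 (is_derive_coord_sub i i (z ord0 i) x))).
    by rewrite eqxx [_%:A]mulr1.
  apply: (is_derive_eq (is_deriveM D1 D2)).
  by rewrite /= /GRing.scale/=; ring.
move=> y; rewrite inE => By; apply: is_derive_partial.
by apply: is_derive_comp_real; [exact: is_derive_sqdist|exact: dF].
Qed.

End Distance.

(** * Second derivative test at a minimum *)

Section SecondDerivativeTest.
Context {R : realType} {N : nat}.
Implicit Types (f : 'rV[R]_N -> R) (A : set 'rV[R]_N) (x : 'rV[R]_N).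
Local Notation e i := (delta_mx ord0 i : 'rV[R]_N).

Lemma line_in_open A x v : open A -> A x ->
  exists2 d : R, 0 < d & forall h : R, `|h| < d -> A (h *: v + x).
Proof.
move=> oA Ax; have c : (h *: v + x) @[h --> (0 : R)] --> x.
  have -> : x = 0 *: v + x :> 'rV[R]_N by rewrite scale0r add0r.
  by apply: cvgD; [exact: scalel_continuous|rewrite scale0r add0r; exact: cvg_cst].
have /c : nbhs x A by exact: open_nbhs_nbhs.
rewrite nbhs_simpl/= => /nbhs_ballP[d /= d0 dA]; exists d => // h hd.
by apply: dA; rewrite /ball/= sub0r normrN.
Qed.

Lemma partial2_min_ge0 A f x i : open A -> Ck 2 A f -> A x ->
  (forall y, A y -> f x <= f y) -> 0 <= partial i (partial i f) x.
Proof.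
move=> oA Cf Ax fmin; have [d d0 dA] := line_in_open (e i) oA Ax.
pose g (h : R) := f (h *: e i + x); pose g1 (h : R) := partial i f (h *: e i + x).
have Dg h : `|h| < d -> is_derive h (1 : R) g (g1 h).
  by move=> /dA Ah; apply: is_derive_line_at; exact: (CkS_is_derive i Cf Ah).
have Dg1 : is_derive (0 : R) (1 : R) g1 (partial i (partial i f) x).
  by apply: is_derive_line_at; rewrite scale0r add0r; exact: (CkS_is_derive i (CkS_partial i Cf) Ax).
have absd h : h \in `](- d), d[%R -> `|h| < d by rewrite in_itv/= ltr_norml.
have g10 : g1 0 = 0.
  have : is_derive (0 : R) (1 : R) g 0.
    apply: (@derive1_at_min R g (- d) d 0).
    - by rewrite ge0_cp// ltW.
    - by move=> h /absd /Dg [].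
    - by rewrite in_itv/= oppr_lt0 d0.
    - move=> h /absd /dA Ah; rewrite /g scale0r add0r; exact: fmin.
  move=> [_ E1]; have [_ E2] : is_derive (0 : R) (1 : R) g (g1 0) by apply: Dg; rewrite normr0.
  exact: etrans (esym E2) E1.
(* If the second derivative were negative, [g1], which vanishes at 0, would be negative just to the
   right of 0, and the mean value theorem would produce a value of g below its minimum. *)
rewrite leNgt; apply/negP => neg.
have : \forall h \near 0^', h^-1 * g1 h < 0.
  case: Dg1 => dv dl; have := dv; rewrite /derivable => /cvg_ex[l cl].
  have El : l = partial i (partial i f) x by rewrite -dl; apply/esym/cvg_lim.
  have {}cl : h^-1 * g1 h @[h --> 0^'] --> l.
    apply: cvg_trans cl; apply: near_eq_cvg; near=> h.
    by rewrite /= addr0 [_%:A]mulr1 g10 subr0.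
  by apply: (cvgr_lt l cl); rewrite El.
move=> [r /= r0 rP].
pose h := Num.min (d / 2) (r / 2).
have h0 : 0 < h by rewrite lt_min !divr_gt0.
have hd : h < d by rewrite gt_min ltr_pdivrMr// ltr_pMr// ltr1n.
have hr : h < r by rewrite gt_min (ltr_pdivrMr _ r)// [r * _ ]mulrC ltr_pMl// ltr1n orbT.
have [c] : exists2 c, c \in `]0, h[%R & g h - g 0 = g1 c * (h - 0).
  apply: MVT => // [y|].
    rewrite in_itv/= => /andP[y0 yh]; apply: Dg.
    by rewrite gtr0_norm// (lt_trans yh).
  apply: derivable_within_continuous => y; rewrite in_itv/= => /andP[y0 yh].
  have [] // : is_derive y (1 : R) g (g1 y).
  by apply: Dg; rewrite ger0_norm// (le_lt_trans yh).
rewrite in_itv/= subr0 => /andP[c0 ch] E.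
have : g1 c < 0.
  have := rP c; rewrite /= sub0r normrN gtr0_norm// => /(_ (lt_trans ch hr)).
  by rewrite gt_eqF// => /(_ isT); rewrite pmulr_rlt0// invr_gt0.
rewrite -(pmulr_llt0 _ h0) -E subr_lt0 ltNge => /negP; apply.
rewrite /g scale0r add0r; apply: fmin; apply: dA.
by rewrite gtr0_norm.
Unshelve. all: by end_near. Qed.

Lemma laplacian_min_ge0 A f x : open A -> Ck 2 A f -> A x ->
  (forall y, A y -> f x <= f y) -> 0 <= laplacian f x.
Proof.
by move=> oA Cf Ax fm; apply: sumr_ge0 => i _; exact: (partial2_min_ge0 i oA Cf Ax fm).
Qed.

End SecondDerivativeTest.

(** * A smooth radial bump *)

Lemma is_deriveV_real {R : realType} (x : R) : x != 0 ->
  is_derive x (1 : R) (fun y : R => y^-1) (- x ^- 2).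
Proof.
move=> x0; have D : derivable (id : R -> R) x 1 by exact: derivable_id.
apply: DeriveDef; first exact: (derivableV x0 D).
by rewrite (deriveV x0 D) derive_id [_ *: 1]mulr1.
Qed.

Lemma is_derive_comp1 {R : realType} (f g : R -> R) (x df dg : R) :
  is_derive x (1 : R) f df -> is_derive (f x) (1 : R) g dg ->
  is_derive x (1 : R) (fun y => g (f y)) (dg * df).
Proof. by move=> hf hg; exact: (@is_derive1_comp R g f x dg df hg hf). Qed.

Lemma quadratic_is_derive0 {R : realType} (f : R -> R) (C : R) :
  (forall h, `|f h| <= C * h ^+ 2) -> is_derive (0 : R) (1 : R) f 0.
Proof.
move=> fC.
have f0 : f 0 = 0.
  by apply/normr0_eq0/le_anti; rewrite normr_ge0 andbT (le_trans (fC 0))// expr0n/= mulr0.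
have C0 : 0 <= C by have := le_trans (normr_ge0 _) (fC 1); rewrite expr1n mulr1.
have cvg0 : h^-1 *: ((f \o shift 0) (h *: 1) - f 0) @[h --> 0^'] --> (0 : R).
  apply/cvgrPdist_le => e e0; near=> h.
  have h0 : h != 0 by near: h; exact: nbhs_dnbhs_neq.
  rewrite sub0r normrN /= addr0 [h *: 1]mulr1 f0 subr0 [_ *: _]/(_ * _) normrM normfV.
  rewrite ler_pdivrMl ?normr_gt0// (le_trans (fC h))//.
  rewrite -real_normK ?num_real// expr2 mulrA [leRHS]mulrC ler_wpM2r//.
  have : `|h| <= e / (C + 1).
    near: h; apply: nbhs_dnbhs => /=; exists (e / (C + 1)) => /=.
      by rewrite divr_gt0// ltr_wpDl.
    by move=> y /=; rewrite sub0r normrN => /ltW.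
  rewrite ler_pdivlMr ?ltr_wpDl// => H; apply: le_trans H.
  by rewrite mulrC ler_wpM2l// lerDl.
apply: DeriveDef; first by apply/cvg_ex; exists 0.
exact/cvg_lim.
Unshelve. all: by end_near. Qed.

Section FlatFunction.
Context {R : realType}.
Implicit Types (t : R) (n : nat).

(** With y = 1/t, the derivative in t of P(y) exp (- y) is y^2 (P(y) - P'(y)) exp (- y), whence the
    recursion. *)
Fixpoint flat_poly n : {poly R} :=
  if n is n'.+1 then 'X^2 * (flat_poly n' - (flat_poly n')^`()) else 1.

(* The n-th derivative of the function exp (-1/t) extended by 0 to t <= 0. *)
Definition flat n t : R :=
  if 0 < t then (flat_poly n).[t^-1] * expR (- t^-1) else 0.

Lemma flat_le0 n t : t <= 0 -> flat n t = 0.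
Proof. by rewrite /flat leNgt => /negbTE ->. Qed.

Lemma poly_le_expR (P : {poly R}) :
  exists C, forall y, 0 <= y -> `|P.[y]| <= C * expR y.
Proof.
exists (\sum_(i < size P) `|P`_i| * i`!%:R) => y y0.
rewrite horner_coef mulr_suml (le_trans (ler_norm_sum _ _ _))//.
apply: ler_sum => -[i ip] _ /=; rewrite normrM -mulrA ler_wpM2l//.
rewrite ger0_norm ?exprn_ge0//; case: i {ip} => [|i].
  by rewrite expr0 fact0 mul1r -expR0 ler_expR.
rewrite mulrC -ler_pdivrMr ?ltr0n ?fact_gt0//.
by apply: le_trans (expR_ge1Dxn i y0); rewrite lerDr.
Qed.

(** exp (1/t) dominates the polynomial t^-2 P_n(1/t). A quadratic bound makes the derivative at 0
    exist and vanish, which is the only delicate point in differentiating [flat]. *)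
Lemma flat_quadratic n : exists C, forall t, `|flat n t| <= C * t ^+ 2.
Proof.
have [C HC] := poly_le_expR ('X^2 * flat_poly n).
exists C => t; have [t0|t0] := ltP 0 t; last first.
  rewrite flat_le0// normr0 mulr_ge0 ?sqr_ge0//.
  by have := le_trans (normr_ge0 _) (HC 0 (lexx _)); rewrite expR0 mulr1.
have H : `|(flat_poly n).[t^-1]| <= C * t ^+ 2 * expR t^-1.
  have := HC t^-1; rewrite invr_ge0 ltW// => /(_ isT).
  rewrite hornerM hornerXn normrM ger0_norm; last by rewrite exprn_ge0// invr_ge0 ltW.
  by rewrite exprVn ler_pdivrMl ?exprn_gt0// mulrCA mulrA.
rewrite /flat t0 normrM (ger0_norm (expR_ge0 _)) expRN.
by rewrite ler_pdivrMr ?expR_gt0.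
Qed.

Lemma is_derive_flat n t : is_derive t (1 : R) (flat n) (flat n.+1 t).
Proof.
have [t0|t0|<-] := ltgtP 0 t.
- have E : \forall y \near t, (flat_poly n).[y^-1] * expR (- y^-1) = flat n y.
    by near=> y; rewrite /flat ifT//; near: y; exact: lt_nbhsr.
  apply: (near_eq_is_derive E).
  have DV := is_deriveV_real (lt0r_neq0 t0).
  have D1 := is_derive_comp1 DV (is_derive_poly (flat_poly n) t^-1).
  have D2 := is_derive_comp1 (is_deriveN DV) (is_derive_expR _).
  apply: (is_derive_eq (is_deriveM D1 D2)).
  rewrite /flat t0 /= !hornerE /GRing.scale/= exprVn; ring.
- rewrite flat_le0 ?ltW//.
  have E : \forall y \near t, cst 0 y = flat n y.
    by near=> y; rewrite flat_le0// ltW//; near: y; exact: lt_nbhsl.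
  exact: (near_eq_is_derive E).
- have [C HC] := flat_quadratic n.
  by rewrite flat_le0//; exact: quadratic_is_derive0 HC.
Unshelve. all: by end_near. Qed.

End FlatFunction.

Section RadialBump.
Context {R : realType} (N : nat) (a lam : R).
Hypotheses (a0 : 0 <= a) (lam0 : 0 < lam).
Implicit Types (s t : R) (x : 'rV[R]_N) (A : set 'rV[R]_N).
Local Notation n := (nu_star R N).

Definition log_scale s : R := (ln s - a) / lam.

(** The index counts derivatives of [flat] taken before composition with y (1 - y), so this is not
    the k-th derivative of [log_bump 0]. *)
Definition log_bump k s : R := flat k (log_scale s * (1 - log_scale s)).

(* With chi t = flat 0 (y (1 - y)), y = (t - a) / lam, this is
   |x|^(- nu_star) chi (ln |x|^2); the weight |x|^(- nu_star) turns
   Laplacian + nu_star^2 / |x|^2 into 4 chi'' / |x|^2. *)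
Definition radial_bump x : R :=
  expR (- (n / 2) * ln (sqdist 0 x)) * log_bump 0 (sqdist 0 x).

Let E s := expR (- (n / 2) * ln s).

Lemma flat0_ge0 t : 0 <= flat 0 t.
Proof.
rewrite /flat; case: ifP => // _.
by rewrite hornerE mul1r expR_ge0.
Qed.

Lemma radial_bump_ge0 x : 0 <= radial_bump x.
Proof. by rewrite mulr_ge0 ?expR_ge0//; exact: flat0_ge0. Qed.

Lemma radial_bump_gt0P x : 0 < radial_bump x <-> a < ln (sqdist 0 x) < a + lam.
Proof.
rewrite pmulr_rgt0 ?expR_gt0// /log_bump /flat.
have -> : (a < ln (sqdist 0 x) < a + lam) =
    (0 < log_scale (sqdist 0 x) * (1 - log_scale (sqdist 0 x))).
  set y := log_scale _.
  have -> : ln (sqdist 0 x) = y * lam + a by rewrite /y /log_scale divfK ?subrK// gt_eqF.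
  rewrite ltrDr pmulr_lgt0// [a + lam]addrC ltrD2r gtr_pMl//.
  have [y0|y0] := ltP 0 y; first by rewrite pmulr_rgt0// subr_gt0.
  apply/esym/negbTE; rewrite -leNgt mulr_le0_ge0// subr_ge0 (le_trans y0)//.
by case: ifP; rewrite ?ltxx// hornerE mul1r expR_gt0.
Qed.

Lemma radial_bump_eq0 x : ~~ (a < ln (sqdist 0 x) < a + lam) -> radial_bump x = 0.
Proof.
move=> h; apply/le_anti; rewrite radial_bump_ge0 andbT leNgt.
by apply: contra h => /radial_bump_gt0P.
Qed.

Definition ln_derivative k s : R :=
  if k is k'.+1 then (-1) ^+ k' * k'`!%:R * (s^-1) ^+ k'.+1 else ln s.

Lemma is_derive_ln_derivative k s : 0 < s ->
  is_derive s (1 : R) (ln_derivative k) (ln_derivative k.+1 s).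
Proof.
move=> s0; case: k => [|k].
  by rewrite /= expr0 fact0 !mul1r; exact: is_derive1_ln.
have DV := is_deriveV_real (lt0r_neq0 s0).
have D := is_deriveZ ((-1) ^+ k * k`!%:R) (is_deriveX k.+1 DV).
have -> : ln_derivative k.+1 = ((-1) ^+ k * k`!%:R) *: ((fun y : R => y^-1) ^+ k.+1).
  by apply/funext => y; rewrite /= exprfctE.
apply: (is_derive_eq D); rewrite /GRing.scale/= -exprVn !exprS factS natrM; ring.
Qed.

Lemma Ck_ln_sqdist k A : open A -> (forall x, A x -> 0 < sqdist 0 x) -> Ck k A (@ln R \o sqdist 0).
Proof.
move=> oA A0; apply: (@Ck_comp _ _ k A (sqdist 0) ln_derivative [set s | 0 < s] 0) => //.
  by move=> l y /= y0; exact: is_derive_ln_derivative.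
exact: Ck_sqdist.
Qed.

Lemma Ck_log_scale k A : open A -> (forall x, A x -> 0 < sqdist 0 x) ->
  Ck k A (log_scale \o sqdist 0).
Proof.
move=> oA A0; apply: (@Ck_eq _ _ k A (fun x => lam^-1 * ((@ln R \o sqdist 0) \- cst a) x)) => //.
  by move=> x _ /=; rewrite mulrC.
by apply: (CkZ _ oA); apply: (CkB oA); [exact: Ck_ln_sqdist|exact: Ck_cst].
Qed.

Lemma smooth_radial_bump : smooth setT radial_bump.
Proof.
move=> k.
have cq := @continuous_sqdist R N 0.
have oA1 : open [set x : 'rV[R]_N | 0 < sqdist 0 x].
  by have /continuousP/(_ _ (@open_gt R 0)) := cq.
have oA2 : open [set x : 'rV[R]_N | sqdist 0 x < 1].
  by have /continuousP/(_ _ (@open_lt R 1)) := cq.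
(* On the first set the bump is a composite of smooth functions. On the second it vanishes, as ln
   |x|^2 <= 0 <= a; this covers the origin, where [ln] takes the default value 0. *)
have -> : [set: 'rV[R]_N] = [set x | 0 < sqdist 0 x] `|` [set x | sqdist 0 x < 1].
  apply/seteqP; split => // x _ /=; have := sqdist_ge0 0 x.
  by rewrite le_eqVlt => /orP[/eqP <-|]; [right|left].
apply: CkU.
  apply: (@CkM _ _ k _ (E \o sqdist 0) (log_bump 0 \o sqdist 0)) => //.
    apply: (@Ck_comp _ _ k _ (fun x => - (n / 2) * (@ln R \o sqdist 0) x) (fun=> expR) setT 0) => //.
    by apply: (CkZ _ oA1); exact: Ck_ln_sqdist.
  apply: (@Ck_comp _ _ k _ ((log_scale \o sqdist 0) \* (cst 1 \- (log_scale \o sqdist 0))) flat setT 0) => //.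
    by move=> l y _; exact: is_derive_flat.
  apply: (CkM oA1); first exact: Ck_log_scale.
  by apply: (CkB oA1); [exact: Ck_cst|exact: Ck_log_scale].
apply: (@Ck_eq _ _ k _ (cst 0)) => //; last exact: Ck_cst.
move=> x; rewrite inE/= => q1; rewrite radial_bump_eq0//.
by rewrite negb_and -leNgt (le_trans _ a0)// ln_le0// ltW.
Qed.

(** Derivative in s = |x|^2 of the radial profile s^(- nu_star / 2) chi (ln s). *)
Let F1 s := E s * (log_bump 1 s * (1 - 2 * log_scale s) / lam - n / 2 * log_bump 0 s) / s.

Let D_log_scale s : 0 < s -> is_derive s (1 : R) log_scale (s^-1 / lam).
Proof.
move=> s0.
have := is_deriveZ lam^-1 (is_deriveB (is_derive1_ln s0) (is_derive_cst a s (1 : R))).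
rewrite subr0 [lam^-1 *: s^-1]mulrC; congr (is_derive _ _ _ _).
by apply/funext => y; rewrite /log_scale mulrC.
Qed.

Let D_log_bump k s : 0 < s -> is_derive s (1 : R) (log_bump k)
  (log_bump k.+1 s * ((1 - 2 * log_scale s) * (s^-1 / lam))).
Proof.
move=> s0; have Dy := D_log_scale s0.
have Dz := is_deriveB (is_derive_cst (1 : R) s (1 : R)) Dy.
have Dw := is_deriveM Dy Dz.
have D := is_derive_comp1 Dw (is_derive_flat k _).
apply: (is_derive_eq D); rewrite /log_bump /GRing.scale/= !fctE; congr (_ * _); ring.
Qed.

Let D_E s : 0 < s -> is_derive s (1 : R) E (- (n / 2) * E s / s).
Proof.
move=> s0.
have D := is_derive_comp1 (is_deriveZ (- (n / 2)) (is_derive1_ln s0)) (is_derive_expR _).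
by apply: (is_derive_eq D); rewrite /E /GRing.scale/=; ring.
Qed.

(** On radial functions, in the variable t = ln |x|^2, the Laplacian is 4 |x|^-2 (d^2/dt^2 + nu_star
    d/dt). The weight exp (- nu_star t / 2) removes the first-order term and creates - nu_star^2 /
    |x|^2. The bracket on the right is lam^2 chi''. *)
Lemma laplacian_radial_bump x : 0 < sqdist 0 x ->
  laplacian radial_bump x + n ^+ 2 * radial_bump x / sqdist 0 x =
  4 * (expR (- (n / 2) * ln (sqdist 0 x)) *
    (log_bump 2 (sqdist 0 x) * (1 - 2 * log_scale (sqdist 0 x)) ^+ 2 -
       2 * log_bump 1 (sqdist 0 x)) / lam ^+ 2) / sqdist 0 x.
Proof.
move=> q0; set q := sqdist 0 x.
pose F s := E s * log_bump 0 s.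
have D1 s : 0 < s -> is_derive s (1 : R) F (F1 s).
  move=> s0; apply: (is_derive_eq (is_deriveM (D_E s0) (D_log_bump 0 s0))).
  by rewrite /F1 /GRing.scale/=; ring.
have DV := is_deriveV_real (lt0r_neq0 q0).
have DH : is_derive q (1 : R) (fun s => (1 - 2 * log_scale s)) (- (2 * (q^-1 / lam))).
  have D := is_deriveB (is_derive_cst (1 : R) q (1 : R)) (is_deriveZ 2 (D_log_scale q0)).
  by rewrite sub0r in D.
have D2 := is_deriveM (is_deriveM (D_E q0)
  (is_deriveB (is_deriveZ lam^-1 (is_deriveM (D_log_bump 1 q0) DH))
     (is_deriveZ (n / 2) (D_log_bump 0 q0)))) DV.
set F2 := (X in is_derive _ _ _ X) in D2.
have DF1 : is_derive q (1 : R) F1 F2.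
  have E1 : E * (lam^-1 *: (log_bump 1 * (fun s => 1 - 2 * log_scale s)) -
      (n / 2) *: log_bump 0) * (fun s => s^-1) = F1.
    by apply/funext => s; rewrite !fctE /F1 /GRing.scale/= [lam^-1 * _]mulrC.
  by rewrite -E1; exact: D2.
rewrite (_ : radial_bump = F \o sqdist 0)//.
rewrite (@laplacian_radial _ _ [set s | 0 < s] F F1 F2)//.
rewrite -/q /F2 /F1 /F /GRing.scale/=.
have -> : N%:R = 2 * n + 2 by rewrite /nu_star; field.
rewrite /E !fctE /GRing.scale/= -/q; set Eq := expR _.
rewrite /GRing.scale/=; field; rewrite !gt_eqF//.
Qed.

(** This bounds the second derivative in y of exp (- 1 / w), w = y (1 - y), from below by - 64 times
    the function itself. Near the edges 1 / w is large and the function is convex, so the ratio is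
    bounded below although the function tends to 0. *)
Lemma flat_convexity_defect s :
  - 64 * log_bump 0 s <=
  log_bump 2 s * (1 - 2 * log_scale s) ^+ 2 - 2 * log_bump 1 s.
Proof.
rewrite /log_bump; set y := log_scale s; set w := y * (1 - y).
have [w0|w0] := ltP 0 w; last by rewrite !flat_le0// !mulr0 mul0r subr0.
have wE : (1 - 2 * y) ^+ 2 = 1 - 4 * w by rewrite /w; ring.
have P1 : flat_poly 1 = 'X^2 :> {poly R} by rewrite /= -polyC1 derivC subr0 mulr1.
have P2 : flat_poly 2 = 'X^2 * ('X^2 - 'X *+ 2) :> {poly R}.
  by rewrite -[LHS]/('X^2 * (flat_poly 1 - (flat_poly 1)^`())) P1 derivXn.
set e := expR (- w^-1); have e0 : 0 < e by exact: expR_gt0.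
have f0 : flat 0 w = e by rewrite /flat w0 hornerC mul1r.
have f1 : flat 1 w = w^-1 ^+ 2 * e by rewrite /flat w0 P1 hornerXn.
have f2 : flat 2 w = w^-1 ^+ 2 * (w^-1 ^+ 2 - 2 * w^-1) * e.
  by rewrite /flat w0 P2 hornerM hornerD hornerN hornerMn !hornerXn hornerX mulr_natl.
(* With z = w^-1, the difference of the two sides is e (z^4 - 6 z^3 + 6 z^2 + 64), written here as a
   sum of squares plus 24. *)
rewrite f0 f1 f2 wE -subr_ge0 [leRHS](_ : _ =
    e * ((w^-1 ^+ 2 - 3 * w^-1 - 2) ^+ 2 + (w^-1 - 6) ^+ 2 + 24)).
  by rewrite mulr_ge0 ?(ltW e0)// !addr_ge0// ?sqr_ge0.
by field; rewrite gt_eqF.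
Qed.

(** 256 = 4 * 64: the 4 comes from the variable ln |x|^2, the 64 from [flat_convexity_defect]. *)
Lemma laplacian_radial_bump_ge x : 0 < sqdist 0 x ->
  - (n ^+ 2 + 256 / lam ^+ 2) * radial_bump x / sqdist 0 x <= laplacian radial_bump x.
Proof.
move=> q0; rewrite -(lerD2r (n ^+ 2 * radial_bump x / sqdist 0 x)) laplacian_radial_bump//.
set q := sqdist 0 x in q0 *.
have -> : - (n ^+ 2 + 256 / lam ^+ 2) * radial_bump x / q + n ^+ 2 * radial_bump x / q =
  4 * (expR (- (n / 2) * ln q) * (- 64 * log_bump 0 q) / lam ^+ 2) / q.
  by rewrite /radial_bump -/q; ring.
rewrite ler_pM2r ?invr_gt0// ler_pM2l// ler_pM2r ?invr_gt0 ?exprn_gt0//.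
by rewrite ler_pM2l ?expR_gt0// flat_convexity_defect.
Qed.

End RadialBump.

(** * Integration of compactly supported functions *)

Section CompactlySupportedIntegrals.
Context {R : realType}.
Local Notation vec N := (fun t : N.-tuple (measurableTypeR R) => \row_(i < N) tnth t i : 'rV[R]_N).

(** The support is bounded coordinatewise: such a bound passes to slices with one coordinate fixed,
    and [lebesgue_tuple_box] gives the measure of the cube. *)
Definition Cc N (f : 'rV[R]_N -> R) : Prop :=
  continuous f /\
  exists2 B : R, 0 <= B & forall (x : 'rV[R]_N) i, B < `|x ord0 i| -> f x = 0.

Lemma rV_ballP N (x y : 'rV[R]_N) (d : R) : 0 < d ->
  (forall i, `|x ord0 i - y ord0 i| < d) -> ball x d y.
Proof. by move=> d0 h; split => // i j; rewrite ord1; exact: h. Qed.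

Lemma open_rational_box N (W : set 'rV[R]_N) x : open W -> W x ->
  exists q : 'rV[rat]_N * nat,
    (forall i, `|x ord0 i - ratr (q.1 ord0 i)| < q.2.+1%:R^-1) /\
    (forall y : 'rV[R]_N, (forall i, `|y ord0 i - ratr (q.1 ord0 i)| < q.2.+1%:R^-1) -> W y).
Proof.
move=> oW Wx; have /nbhs_ballP[e /= e0 eW] : nbhs x W by exact: open_nbhs_nbhs.
have [k] : exists k : nat, k.+1%:R^-1 < e / 2.
  have := @near_infty_natSinv_lt R (PosNum (divr_gt0 e0 (ltr0n R 2))).
  by move=> [k _ /(_ k) /= H]; exists k; exact: H.
set d := k.+1%:R^-1 => de; have d0 : 0 < d by rewrite invr_gt0.
have /choice[q qP] : forall i : 'I_N, exists r : rat, `|x ord0 i - ratr r| < d.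
  move=> i; have [r] : exists r, ratr r \in `]x ord0 i - d, x ord0 i + d[.
    by apply: rat_in_itvoo; rewrite ltrBlDr -addrA ltrDl addr_gt0.
  rewrite in_itv/= => /andP[r1 r2]; exists r.
  by rewrite ltr_norml; apply/andP; split; lra.
exists (\row_i q i, k); split=> [i|y hy]; first by rewrite mxE; exact: qP.
apply: eW; apply: rV_ballP => // i.
have := qP i; have := hy i; rewrite mxE /= -/d.
by rewrite !ltr_norml => /andP[? ?] /andP[? ?]; apply/andP; split; lra.
Qed.

(** Measurable sets of tuples are generated by coordinates, whereas W is open for the topology of
    row vectors. The two meet because W is a countable union of cubes with rational centres and
    radii 1 / (k + 1). *)
Lemma measurable_vec_preimage N (W : set 'rV[R]_N) : open W ->
  measurable ((vec N) @^-1` W).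
Proof.
move=> oW.
pose box (q : 'rV[rat]_N * nat) : set (N.-tuple (measurableTypeR R)) :=
  \bigcap_(i in [set: 'I_N]) ((@tnth _ _)^~ i @^-1`
    [set s : R | `|s - ratr (q.1 ord0 i)| < q.2.+1%:R^-1]).
pose good := [set q : 'rV[rat]_N * nat | forall y : 'rV[R]_N,
  (forall i, `|y ord0 i - ratr (q.1 ord0 i)| < q.2.+1%:R^-1) -> W y].
have -> : (vec N) @^-1` W = \bigcup_q (if pselect (good q) then box q else set0).
  apply/seteqP; split => [t /= Wt|t [q _]].
    have [q [q1 q2]] := open_rational_box oW Wt.
    exists q => //; case: pselect => // _ i _ /=.
    by have := q1 i; rewrite mxE.
  case: pselect => // gq bq; apply: (gq) => i; rewrite mxE; exact: bq.
apply: countable_bigcupT_measurable; first exact: countableP.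
move=> q; case: pselect => [gq|gq]; last exact: measurable0.
rewrite /box; apply: fin_bigcap_measurable => // i _.
rewrite -[X in measurable X]setTI; apply: measurable_tnth => //.
apply: open_measurable.
have c : continuous (fun s : R => `|s - ratr (q.1 ord0 i)|).
  move=> s; apply: cvg_norm; apply: cvgB; [exact: cvg_id|exact: cvg_cst].
by have /continuousP/(_ _ (@open_lt R q.2.+1%:R^-1)) := c.
Qed.

Lemma measurable_vec N (f : 'rV[R]_N -> R) : continuous f ->
  measurable_fun setT (f \o vec N).
Proof.
move=> /continuousP cf; apply: (measurability _ (RGenOpens.measurableE R)).
move=> _ [_ [a [b ->] <-]]; rewrite setTI.
apply: (@measurable_vec_preimage N (f @^-1` `]a, b[%classic)).
exact/cf/interval_open.
Qed.

Lemma Cc_bounded N (f : 'rV[R]_N -> R) : Cc f ->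
  exists2 M : R, 0 <= M & forall x, `|f x| <= M.
Proof.
move=> [cf [B B0 fB]].
have cK : compact [set v : 'rV[R]_N | forall i, `[- B, B]%classic (v ord0 i)].
  by apply: (@rV_compact _ _ (fun=> `[- B, B]%classic)) => _; exact: segment_compact.
have cnf : continuous (fun x => `|f x|) by move=> x; apply: continuous_comp; [exact: cf|exact: norm_continuous].
have [|c _ cM] := compact_EVT_max _ cK (continuous_subspaceT cnf).
  by exists 0 => i /=; rewrite mxE in_itv/= oppr_le0 B0.
exists `|f c| => // x.
have [h|/existsNP[i]] := pselect (forall i, `[- B, B]%classic (x ord0 i)).
  by apply: cM; rewrite inE.
move=> /negP; rewrite in_itv/= -ler_norml -ltNge => /fB ->.
by rewrite normr0.
Qed.

Lemma Cc_integrable N (f : 'rV[R]_N -> R) : Cc f ->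
  (lebesgue_tuple R N).-integrable setT (EFin \o (f \o vec N)).
Proof.
move=> Cf; have [cf [B B0 fB]] := Cf; have [M M0 fM] := Cc_bounded Cf.
pose K : set (N.-tuple (measurableTypeR R)) := [set t | forall i, `[- B, B]%classic (tnth t i)].
have muK : lebesgue_tuple R N K = (\prod_(i < N) (B + B)%:E)%E.
  rewrite [LHS](lebesgue_tuple_box (fun=> measurable_itv _)).
  apply: eq_bigr => i _; rewrite lebesgue_measure_itv/= lte_fin -EFinB opprK.
  by case: ltP => // B1; (have -> : B = 0 by lra); rewrite addr0.
have muKoo : (lebesgue_tuple R N K < +oo)%E.
  rewrite [X in (X < _)%E]muK; have : (\prod_(i < N) (B + B)%:E)%E \is a fin_num.
    by apply: (big_ind (fun x : \bar R => x \is a fin_num)) => // x y; exact: fin_numM.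
  by move=> h; rewrite ltey_eq h.
have mK : measurable K.
  have -> : K = \bigcap_(i in [set: 'I_N]) ((@tnth _ _)^~ i @^-1` `[- B, B]%classic).
    by apply/seteqP; split => [t h i _|t h i]; exact: h.
  apply: fin_bigcap_measurable => // i _.
  by rewrite -[X in measurable X]setTI; exact: measurable_tnth.
have -> : EFin \o (f \o vec N) = (EFin \o (f \o vec N)) \_ K.
  apply/funext => t; rewrite /patch; case: ifPn => //= tK.
  have /existsNP[i] : ~ (forall i, `[- B, B]%classic (tnth t i)).
    by move=> h; move/negP: tK; apply; rewrite inE.
  move=> /negP; rewrite in_itv/= -ler_norml -ltNge => h.
  by rewrite (fB _ i)// mxE.
apply/(integrable_mkcond _ mK).
apply: (measurable_bounded_integrable mK muKoo).
- by apply: measurable_funTS; exact: measurable_vec.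
- by exists M; split; [exact: num_real|move=> y My t _; apply: le_trans (ltW My); exact: fM].
Qed.


(** By continuity f exceeds f x0 / 2 on a sup-norm ball around x0, which is a cube of positive
    measure. *)
Lemma integral_rV_gt0 N (f : 'rV[R]_N -> R) x0 : Cc f -> (forall x, 0 <= f x) ->
  0 < f x0 -> 0 < integral_rV f.
Proof.
move=> Cf f0 fx0; have [cf _] := Cf.
have [e /= e0 eW] : exists2 e : R, 0 < e & ball x0 e `<=` [set x | f x0 / 2 < f x].
  have := cvgr_gt (f x0) (cf x0); have h2 : f x0 / 2 < f x0 by lra.
  move=> /(_ _ _ h2) /nbhs_ballP[e /= e0 eW]; exists e => //.
pose W : set (N.-tuple (measurableTypeR R)) :=
  [set t | forall i, ball (x0 ord0 i) e (tnth t i)].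
have muW : lebesgue_tuple R N W = (\prod_(i < N) (e *+ 2)%:E)%E.
  rewrite [LHS](@lebesgue_tuple_box R N (fun i => ball (x0 ord0 i) e) (fun i => measurable_ball _ _)).
  by apply: eq_bigr => i _; rewrite lebesgue_measure_ball// ltW.
have mW : measurable W.
  have -> : W = \bigcap_(i in [set: 'I_N]) ((@tnth _ _)^~ i @^-1` ball (x0 ord0 i) e).
    by apply/seteqP; split => [t h i _|t h i]; exact: h.
  apply: fin_bigcap_measurable => // i _.
  by rewrite -[X in measurable X]setTI; apply: measurable_tnth => //; exact: measurable_ball.
have If := Cc_integrable Cf.
rewrite /integral_rV /Rintegral; apply: fine_gt0; apply/andP; split; last first.
  exact: integrable_lty.
apply: (@lt_le_trans _ _ (\int[lebesgue_tuple R N]_(t in W) (f x0 / 2)%:E)%E).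
  rewrite integral_cst// [X in (_ * X)%E]muW mule_gt0//; first by rewrite lte_fin; lra.
  apply: (big_ind (fun x : \bar R => (0 < x)%E)) => // [x y|i _]; first exact: mule_gt0.
  by rewrite lte_fin mulrn_wgt0.
have mf := measurable_vec cf.
apply: (@le_trans _ _ (\int[lebesgue_tuple R N]_(t in W) (f (vec N t))%:E)%E).
  apply: ge0_le_integral => //.
  - by move=> t _; rewrite lee_fin; lra.
  - by apply/measurable_EFinP; exact: measurable_funTS.
  - move=> t Wt; rewrite lee_fin ltW//; apply: eW.
    by apply: rV_ballP => // i; rewrite mxE; exact: Wt.
apply: ge0_subset_integral => //.
- exact/measurable_EFinP.
- by move=> t _; rewrite lee_fin.
Qed.

End CompactlySupportedIntegrals.

(** * Vanishing of the integral of a partial derivative *)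

Section IntegralOfPartialDerivative.
Context {R : realType}.
Local Notation vec N := (fun t : N.-tuple (measurableTypeR R) => \row_(i < N) tnth t i : 'rV[R]_N).
Local Notation e i := (delta_mx ord0 i).

Lemma integral_derive_compact (h h' : R -> R) (B : R) : 0 <= B ->
  (forall x, is_derive x (1 : R) h (h' x)) -> continuous h' ->
  (forall x, B < `|x| -> h x = 0 /\ h' x = 0) ->
  (\int[lebesgue_measure]_x (h' x)%:E = 0)%E.
Proof.
(* The margin 1 places the endpoints strictly beyond B, where h vanishes. *)
move=> B0 dh ch' hB; pose I := `[- (B + 1), B + 1]%classic.
have -> : (fun x => (h' x)%:E) = (fun x => (h' x)%:E) \_ I.
  apply/funext => x; rewrite /patch; case: ifPn => // /negP xI.
  rewrite (proj2 (hB x _))// ltNge; apply/negP => xB; apply: xI.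
  by rewrite inE /I /= in_itv/= -ler_norml (le_trans xB)// lerDl.
have ch x : {for x, continuous h}.
  by apply: differentiable_continuous; apply/derivable1_diffP; case: (dh x).
rewrite -integral_mkcond (@continuous_FTC2 _ h' h).
- have n1 : `|B + 1| = B + 1 by rewrite ger0_norm//; lra.
  rewrite (proj1 (hB (B + 1) _)) ?n1 ?ltrDl//.
  by rewrite (proj1 (hB (- (B + 1)) _)) ?normrN ?n1 ?ltrDl// subee.
- lra.
- exact: continuous_subspaceT.
- split.
  + by move=> x _; case: (dh x).
  + apply: cvg_at_right_filter; exact: ch.
  + apply: cvg_at_left_filter; exact: ch.
- by move=> x _; rewrite derive1E; case: (dh x).
Qed.

(** Counterpart on row vectors of [cons_prod], along which [lebesgue_tuple] is built. *)
Definition rV_cons n (x : R) (v : 'rV[R]_n) : 'rV[R]_n.+1 :=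
  \row_k oapp (v ord0) x (unlift ord0 k).

Lemma rV_cons0 n x (v : 'rV[R]_n) : rV_cons x v ord0 ord0 = x.
Proof. by rewrite mxE unlift_none. Qed.

Lemma rV_cons_lift n x (v : 'rV[R]_n) j : rV_cons x v ord0 (lift ord0 j) = v ord0 j.
Proof. by rewrite mxE liftK. Qed.

Lemma vec_cons n (x : R) (t : n.-tuple (measurableTypeR R)) :
  vec n.+1 (cons_prod (x, t)) = rV_cons x (vec n t).
Proof.
apply/rowP => i; case: (unliftP ord0 i) => [j ->|->].
  by rewrite rV_cons_lift !mxE tnthS.
by rewrite rV_cons0 !mxE.
Qed.

Lemma rV_cons_shift0 n (h x : R) (v : 'rV[R]_n) :
  rV_cons (h + x) v = h *: e ord0 + rV_cons x v.
Proof.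
apply/rowP => i; case: (unliftP ord0 i) => [j ->|->].
  by rewrite !mxE !liftK/= mulr0 add0r.
by rewrite !mxE unlift_none/= mulr1.
Qed.

Lemma rV_cons_shift_lift n (h x : R) j (v : 'rV[R]_n) :
  rV_cons x (h *: e j + v) = h *: e (lift ord0 j) + rV_cons x v.
Proof.
apply/rowP => i; case: (unliftP ord0 i) => [k ->|->].
  by rewrite !mxE !liftK/= !mxE !eqxx/= (inj_eq lift_inj).
by rewrite !mxE unlift_none/= mulr0 add0r.
Qed.

Lemma continuous_rV_cons n x : continuous (@rV_cons n x).
Proof.
move=> v A /nbhs_ballP[d /= d0 dA]; change (nbhs v (rV_cons x @^-1` A)).
apply/nbhs_ballP; exists d => //= w [_ vw]; apply: dA; split => // i j; rewrite ord1.
case: (unliftP ord0 j) => [k ->|->]; first by rewrite !rV_cons_lift; exact: vw.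
by rewrite !rV_cons0; exact: ballxx.
Qed.

Lemma continuous_rV_cons_l n (v : 'rV[R]_n) : continuous (fun x : R => rV_cons x v).
Proof.
move=> x A /nbhs_ballP[d /= d0 dA]; change (nbhs x ((fun x : R => rV_cons x v) @^-1` A)).
apply/nbhs_ballP; exists d => //= w xw; apply: dA; split => // i j; rewrite ord1.
case: (unliftP ord0 j) => [k ->|->]; last by rewrite !rV_cons0.
by rewrite !rV_cons_lift; exact: ballxx.
Qed.

Lemma Cc_rV_cons n x (f : 'rV[R]_n.+1 -> R) : Cc f -> Cc (f \o rV_cons x).
Proof.
move=> [cf [B B0 fB]]; split.
  by move=> v; apply: continuous_comp; [exact: continuous_rV_cons|exact: cf].
by exists B => // v i vi; apply: (fB _ (lift ord0 i)); rewrite rV_cons_lift.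
Qed.

(** [lebesgue_tuple R n.+1] is a pushforward of a product measure, so this is a change of variables.
    The integrability on the product is what Fubini's theorem asks for. *)
Lemma integral_lebesgue_tupleS n (g : 'rV[R]_n.+1 -> R) : Cc g ->
  let G (z : measurableTypeR R * n.-tuple (measurableTypeR R)) :=
    (g (rV_cons z.1 (vec n z.2)))%:E in
  (@lebesgue_measure R \x lebesgue_tuple R n)%E.-integrable setT G /\
  (\int[lebesgue_tuple R n.+1]_t (g (vec n.+1 t))%:E =
   \int[(@lebesgue_measure R \x lebesgue_tuple R n)%E]_z G z)%E.
Proof.
move=> Cg G; have Ig := Cc_integrable Cg.
have mg : measurable_fun setT (EFin \o (g \o vec n.+1)).
  by apply/measurable_EFinP; apply: measurable_vec; case: Cg.
have GE : G = (EFin \o (g \o vec n.+1)) \o @cons_prod R n.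
  by apply/funext => -[x t]; rewrite /G /= vec_cons.
have IG : (@lebesgue_measure R \x lebesgue_tuple R n)%E.-integrable setT G.
  apply/integrableP; split.
    by rewrite GE; apply: measurableT_comp => //; exact: measurable_cons_prod.
  have /integrableP[_] := Ig; apply: le_lt_trans.
  rewrite [leRHS](@ge0_integral_pushforward _ _ _ _ R _ (@measurable_cons_prod R n)
    (@lebesgue_measure R \x lebesgue_tuple R n)%E setT (abse \o (EFin \o (g \o vec n.+1))))//.
  - by rewrite preimage_setT GE.
  - exact: measurableT_comp.
  - by move=> t _; exact: abse_ge0.
split => //.
rewrite [LHS](@integral_pushforward _ _ _ _ R _ (@measurable_cons_prod R n)
  (@lebesgue_measure R \x lebesgue_tuple R n)%E setT (EFin \o (g \o vec n.+1)))//.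
  by rewrite preimage_setT GE.
by rewrite preimage_setT -GE.
Qed.

(** By Fubini and induction on the dimension. When i is the first coordinate, the inner integral is
    taken in it and vanishes by the fundamental theorem of calculus; otherwise the first coordinate
    is frozen and the induction hypothesis applies to the slice. *)
Lemma integral_partial n (f : 'rV[R]_n -> R) i : Cc f -> Cc (partial i f) ->
  (forall x, derivable f x (e i)) ->
  (\int[lebesgue_tuple R n]_t (partial i f (vec n t))%:E = 0)%E.
Proof.
elim: n f i => [|n IH] f i; first by case: i.
move=> Cf Cpf df; have [IG ->] := integral_lebesgue_tupleS Cpf.
have D x : is_derive x (e i) f (partial i f x) by apply/derivableP.
case: (unliftP ord0 i) => [j ij|i0].
  rewrite -integral12_prod_meas1//; apply: integral0_eq => x _.
  have Dj v : is_derive v (e j) (f \o rV_cons x) (partial i f (rV_cons x v)).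
    apply/is_derive_lineP.
    have -> : (fun h : R => (f \o rV_cons x) (h *: e j + v)) =
              (fun h : R => f (h *: e i + rV_cons x v)).
      by apply/funext => h /=; rewrite rV_cons_shift_lift ij.
    exact: (is_derive_lineP f (rV_cons x v) (e i) _).1 (D _).
  have E : partial i f \o rV_cons x = partial j (f \o rV_cons x).
    by apply/funext => v; rewrite (is_derive_partial (Dj v)).
  have := IH (f \o rV_cons x) j (Cc_rV_cons x Cf).
  rewrite -E => /(_ (Cc_rV_cons x Cpf)); apply=> v.
  by case: (Dj v).
rewrite -integral21_prod_meas1//; apply: integral0_eq => t _.
have [cf [B B0 fB]] := Cf; have [cpf [B' B'0 fB']] := Cpf.
apply: (@integral_derive_compact (fun x => f (rV_cons x (vec n t)))
  (fun x => partial i f (rV_cons x (vec n t))) (Num.max B B')).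
- by rewrite le_max B0.
- move=> x; have := @is_derive_line_at _ _ f (rV_cons 0 (vec n t)) (e i) x (partial i f (rV_cons x (vec n t))).
  have E h : h *: e i + rV_cons 0 (vec n t) = rV_cons h (vec n t).
    by rewrite i0 -rV_cons_shift0 addr0.
  by rewrite E => /(_ (D _)); congr (is_derive _ _ _ _); apply/funext => h; rewrite E.
- move=> x; apply: continuous_comp; [exact: continuous_rV_cons_l|exact: cpf].
- move=> x; rewrite gt_max => /andP[Bx B'x]; split.
    by apply: (fB _ ord0); rewrite rV_cons0.
  by apply: (fB' _ ord0); rewrite rV_cons0.
Qed.

End IntegralOfPartialDerivative.

(** * Integration by parts *)

Section CompactSupportCalculus.
Context {R : realType} {N : nat}.
Implicit Types (f g : 'rV[R]_N -> R) (x : 'rV[R]_N).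

Lemma CcD f g : Cc f -> Cc g -> Cc (f \+ g).
Proof.
move=> [cf [B B0 fB]] [cg [B' B'0 gB']]; split.
  by move=> x; apply: continuousD; [exact: cf|exact: cg].
exists (Num.max B B'); first by rewrite le_max B0.
move=> x i; rewrite gt_max => /andP[Bx B'x] /=.
by rewrite (fB _ _ Bx) (gB' _ _ B'x) addr0.
Qed.

Lemma CcM f g : Cc f -> continuous g -> Cc (f \* g).
Proof.
move=> [cf [B B0 fB]] cg; split.
  by move=> x; apply: continuousM; [exact: cf|exact: cg].
by exists B => // x i Bx /=; rewrite (fB _ _ Bx) mul0r.
Qed.

Lemma CcZ f (c : R) : Cc f -> Cc (fun x => c * f x).
Proof.
move=> Cf; have -> : (fun x => c * f x) = f \* cst c by apply/funext => x /=; rewrite mulrC.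
by apply: CcM => // x; exact: cst_continuous.
Qed.

Lemma Cc_sum n (F : 'I_n -> 'rV[R]_N -> R) :
  (forall i, Cc (F i)) -> Cc (fun x => \sum_(i < n) F i x).
Proof.
elim: n F => [|n IH] F CF.
  split=> [x|]; last by exists 0 => // x i _; rewrite big_ord0.
  by under eq_fun do rewrite big_ord0; exact: cst_continuous.
have -> : (fun x => \sum_(i < n.+1) F i x) =
  (fun x => \sum_(i < n) F (widen_ord (leqnSn n) i) x) \+ F ord_max.
  by apply/funext => x; rewrite big_ord_recr.
by apply: CcD => //; apply: IH.
Qed.

Lemma integral_rVD f g : Cc f -> Cc g ->
  integral_rV (f \+ g) = integral_rV f + integral_rV g.
Proof. by move=> Cf Cg; apply: RintegralD => //; exact: Cc_integrable. Qed.

Lemma integral_rVZ f (c : R) : Cc f ->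
  integral_rV (fun x => c * f x) = c * integral_rV f.
Proof. by move=> Cf; apply: RintegralZl => //; exact: (Cc_integrable Cf). Qed.

Lemma integral_rV_sum n (F : 'I_n -> 'rV[R]_N -> R) : (forall i, Cc (F i)) ->
  integral_rV (fun x => \sum_(i < n) F i x) = \sum_(i < n) integral_rV (F i).
Proof.
elim: n F => [|n IH] F CF.
  rewrite big_ord0 /integral_rV; under eq_Rintegral do rewrite big_ord0.
  by rewrite Rintegral_cst// mul0r.
rewrite big_ord_recr/= -IH// -integral_rVD//; last by apply: Cc_sum => i; exact: CF.
by congr integral_rV; apply/funext => x; rewrite big_ord_recr.
Qed.

Lemma integral_rV_partial f i : Cc f -> Cc (partial i f) ->
  (forall x, derivable f x (delta_mx ord0 i)) -> integral_rV (partial i f) = 0.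
Proof. by move=> Cf Cpf df; rewrite /integral_rV /Rintegral integral_partial. Qed.

Lemma partial_eq0 A f i x : open A -> A x -> (forall y, A y -> f y = 0) ->
  partial i f x = 0.
Proof.
move=> oA Ax f0; rewrite (@partial_eq _ _ A f (cst 0))//.
  exact: derive_cst.
by move=> y; rewrite inE => /f0.
Qed.

Lemma Cc_partial f i : Ck 1 setT f -> Cc f -> Cc (partial i f).
Proof.
move=> Cf [cf [B B0 fB]]; split.
  by move=> x; exact: (Ck_continuous (CkS_partial i Cf)).
exists B => // x j xB.
have oA : open [set y : 'rV[R]_N | B < `|y ord0 j|].
  have c : continuous (fun y : 'rV[R]_N => `|y ord0 j|).
    by move=> y; apply: continuous_comp; [exact: coord_continuous|exact: norm_continuous].
  by have /continuousP/(_ _ (@open_gt R B)) := c.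
by apply: (partial_eq0 i oA xB) => y /fB.
Qed.

(** The field f grad f has compact support and divergence |grad f|^2 + f Laplacian f, so the latter
    integrates to 0. *)
Lemma integral_grad_sqr f : Ck 2 setT f -> Cc f ->
  integral_rV (grad_sqr f) = - integral_rV (f \* laplacian f).
Proof.
move=> Cf Ccf; have C1 := CkW Cf.
pose F i := f \* partial i f.
have Cp i : Cc (partial i f) by exact: Cc_partial.
have Cpp i : Cc (partial i (partial i f)).
  by apply: Cc_partial; [exact: CkS_partial|exact: Cp].
have cf : continuous f by case: Ccf.
have D i x : is_derive x (delta_mx ord0 i) (F i)
    (partial i f x ^+ 2 + f x * partial i (partial i f) x).
  have D1 := CkS_is_derive i C1 (I : setT x).
  have D2 := CkS_is_derive i (CkS_partial i Cf) (I : setT x).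
  apply: (is_derive_eq (is_deriveM D1 D2)).
  by rewrite addrC expr2.
have E i : partial i (F i) =
    (partial i f \* partial i f) \+ (f \* partial i (partial i f)).
  by apply/funext => x; rewrite (is_derive_partial (D i x)).
have cp i : continuous (partial i f) by case: (Cp i).
have cpp i : continuous (partial i (partial i f)) by case: (Cpp i).
have CF i : Cc (partial i (F i)).
  by rewrite E; apply: CcD; apply: CcM.
have I0 i : integral_rV (partial i (F i)) = 0.
  by apply: (integral_rV_partial (CcM Ccf (cp i)) (CF i)) => x; case: (D i x).
have Cg : Cc (grad_sqr f) by apply: Cc_sum => i; exact: CcM.
have Cl : Cc (laplacian f) by apply: Cc_sum => i; exact: Cpp.
apply/eqP; rewrite -addr_eq0 -integral_rVD//; last by apply: CcM => //; case: Cl.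
have -> : grad_sqr f \+ f \* laplacian f = fun x => \sum_(i < N) partial i (F i) x.
  apply/funext => x; rewrite /grad_sqr /laplacian /= mulr_sumr -big_split/=.
  by apply: eq_bigr => i _; rewrite E.
by rewrite integral_rV_sum// big1.
Qed.

End CompactSupportCalculus.

(** * Strong maximum principle *)

Section StrongMaximumPrinciple.
Context {R : realType} {N : nat}.
Implicit Types (w : 'rV[R]_N -> R) (A : set 'rV[R]_N) (x y z : 'rV[R]_N).

Lemma sqdist_coord z x i : (x ord0 i - z ord0 i) ^+ 2 <= sqdist z x.
Proof. by rewrite /sqdist (bigD1 i)//= lerDl sumr_ge0// => j _; exact: sqr_ge0. Qed.

Lemma open_sqball z (rho : R) : open [set x | sqdist z x < rho].
Proof. by have /continuousP/(_ _ (@open_lt R rho)) := @continuous_sqdist R N z. Qed.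

Lemma open_sqexterior z (rho : R) : open [set x | rho < sqdist z x].
Proof. by have /continuousP/(_ _ (@open_gt R rho)) := @continuous_sqdist R N z. Qed.

Lemma compact_sqball z (rho : R) : compact [set x | sqdist z x <= rho].
Proof.
have cK : compact [set v : 'rV[R]_N | forall i,
    `[z ord0 i - (rho + 1), z ord0 i + (rho + 1)]%classic (v ord0 i)].
  apply: (@rV_compact _ _ (fun i => `[z ord0 i - (rho + 1), z ord0 i + (rho + 1)]%classic)).
  by move=> i; exact: segment_compact.
apply: subclosed_compact cK _.
  by have /continuous_closedP/(_ _ (@closed_le R rho)) := @continuous_sqdist R N z.
move=> x /= xr i /=; rewrite in_itv/=.
have := le_trans (sqdist_coord z x i) xr; set t := x ord0 i; set s := z ord0 i => H.
have s1 := sqr_ge0 (t - s - 1); have s2 := sqr_ge0 (t - s + 1); have s3 := sqr_ge0 (t - s).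
by apply/andP; split; lra.
Qed.

Lemma positive_near_center w z : {for z, continuous w} -> 0 < w z ->
  exists2 d : R, 0 < d & forall y, sqdist z y <= d -> w z / 2 <= w y.
Proof.
move=> cw wz; have h2 : w z / 2 < w z by lra.
have := cvgr_gt (w z) cw; move=> /(_ _ _ h2) /nbhs_ballP[d /= d0 dW].
(* A Euclidean ball of squared radius d^2 / 2 lies in the open sup-norm ball of radius d. *)
exists (d ^+ 2 / 2); first by rewrite divr_gt0// exprn_gt0.
move=> y yd; apply/ltW/dW/rV_ballP => // j.
have := le_trans (sqdist_coord z y j) yd.
rewrite distrC -(@ltr_pXn2r _ 2) ?nnegrE ?normr_ge0 ?(ltW d0)// real_normK ?num_real// => H.
by have := exprn_gt0 2 d0; lra.
Qed.

Lemma laplacian_gaussian z x (al : R) :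
  laplacian ((fun s => expR (- al * s)) \o sqdist z) x =
  (4 * al ^+ 2 * sqdist z x - 2 * N%:R * al) * expR (- al * sqdist z x).
Proof.
have D s : is_derive s (1 : R) (fun s => expR (- al * s)) (expR (- al * s) * (- al * 1)).
  exact: (is_derive_comp1 (is_deriveZ (- al) (is_derive_id s (1 : R))) (is_derive_expR _)).
have D' s : is_derive s (1 : R) (fun s => expR (- al * s)) (- al * expR (- al * s)).
  by apply: (is_derive_eq (D s)); rewrite mulr1 mulrC.
have D2 := is_deriveZ (- al) (D' (sqdist z x)).
rewrite (@laplacian_radial _ _ setT _ _ _ z x openT (fun s _ => D' s) I D2).
by rewrite /GRing.scale/=; ring.
Qed.

Lemma Ck_gaussian k A z (al : R) : open A ->
  Ck k A ((fun s => expR (- al * s)) \o sqdist z).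
Proof.
move=> oA.
apply: (@Ck_comp _ _ k A (fun x => - al * sqdist z x) (fun=> expR) setT 0) => //.
by apply: CkZ => //; exact: Ck_sqdist.
Qed.

(* Comparison with a multiple of exp (- al |x - z|^2) - exp (- al rho). *)
Lemma positive_in_ball w A z (rho M : R) : open A ->
  [set x | sqdist z x <= rho] `<=` A -> Ck 2 A w ->
  (forall x, A x -> 0 <= w x) -> 0 <= M ->
  (forall x, A x -> laplacian w x <= M * w x) ->
  0 < w z -> forall x, sqdist z x < rho -> 0 < w x.
Proof.
move=> oA BA Cw w0 M0 Lw wz x xrho.
have rho0 : 0 < rho by rewrite (le_lt_trans _ xrho)// sqdist_ge0.
have sqz : sqdist z z = 0 by rewrite /sqdist big1// => i _; rewrite subrr expr0n.
have Az : A z by apply: BA; rewrite /= sqz ltW.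
have [d d0 dw] := positive_near_center (Ck_continuous Cw Az) wz.
set eps := w z / 2 in dw; have eps0 : 0 < eps by rewrite divr_gt0.
(* Since 4 d b = 2 N + M + 1 and al > 1, the factor 4 al^2 |x - z|^2 - 2 N al in the Laplacian of
   the Gaussian exceeds M as soon as |x - z|^2 > d. *)
pose b := (2 * N%:R + M + 1) / (4 * d); pose al := b + 1.
have bE : 4 * d * b = 2 * N%:R + M + 1 by rewrite /b mulrC divfK// gt_eqF// mulr_gt0.
have b0 : 0 < b by rewrite divr_gt0 ?mulr_gt0// ltr_wpDl// addr_ge0// mulr_ge0.
have al0 : 0 < al by rewrite addr_gt0.
pose g := (fun s => expR (- al * s)) \o sqdist z.
pose eta := g \- cst (expR (- al * rho)).
pose h := (fun y => 1 * w y) \+ (fun y => - eps * eta y).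
have Cg := @Ck_gaussian 2 A z al oA.
have Ceta : Ck 2 A eta := CkB oA Cg (Ck_cst 2 A (expR (- al * rho))).
have Ch : Ck 2 A h := CkD oA (CkZ 1 oA Cw) (CkZ (- eps) oA Ceta).
have hE y : h y = w y - eps * (g y - expR (- al * rho)) by rewrite /h /= mul1r mulNr.
have g_gt0 y : 0 < g y by exact: expR_gt0.
have [c] : exists2 c, c \in [set x | sqdist z x <= rho] &
    forall t, t \in [set x | sqdist z x <= rho] -> h c <= h t.
  apply: EVT_min_rV; [by exists z; rewrite /= sqz ltW|exact: compact_sqball|].
  apply/continuous_in_subspaceT => y; rewrite inE => /BA Ay.
  exact: (Ck_continuous Ch Ay).
rewrite inE/= => crho cmin.
suff hc : 0 <= h c.
  have : 0 <= h x by apply: le_trans hc _; apply: cmin; rewrite inE /= ltW.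
  rewrite hE subr_ge0; apply: lt_le_trans.
  by rewrite mulr_gt0// subr_gt0 ltr_expR !mulNr ltrN2 ltr_pM2l.
(* A negative minimum of h is neither near z, where w >= eps >= eps g, nor on the sphere, where
   [eta] vanishes. In the shell between, h < 0 gives Laplacian w <= M w <= M eps g < eps Laplacian
   g, so Laplacian h < 0 at an interior minimum. *)
rewrite leNgt; apply/negP => hc0.
have erho : 0 < expR (- al * rho) by exact: expR_gt0.
have g1 y : g y <= 1.
  by rewrite -expR0 ler_expR mulNr oppr_le0 mulr_ge0 ?sqdist_ge0 ?ltW.
have Ac : A c by exact: BA.
have dc : d < sqdist z c.
  rewrite ltNge; apply/negP => /dw cw; move: hc0; rewrite hE.
  by have := g1 c; nra.
have {}crho : sqdist z c < rho.
  rewrite lt_neqAle crho andbT; apply/eqP => crho'; move: hc0.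
  by rewrite hE /g /= crho' subrr mulr0 subr0 ltNge w0.
have oB : open ([set x | sqdist z x < rho]) by exact: open_sqball.
have BsubA : [set x | sqdist z x < rho] `<=` A by move=> y /= /ltW; exact: BA.
have : 0 <= laplacian h c.
  apply: (laplacian_min_ge0 oB (Ck_sub BsubA Ch)) => //= y yrho.
  by apply: cmin; rewrite inE/= ltW.
have -> : laplacian h c = laplacian w c - eps * laplacian g c.
  rewrite (laplacian_linear 1 (- eps) oA Cw Ceta Ac) mul1r mulNr; congr (_ - _ * _).
  have -> : eta =
      (fun y => 1 * g y + (- expR (- al * rho)) * cst 1 y).
    by apply/funext => y /=; rewrite mul1r mulr1.
  rewrite (laplacian_linear 1 _ oA Cg (Ck_cst _ _ _) Ac) mul1r.
  rewrite [laplacian (cst 1) c](_ : _ = 0) ?mulr0 ?addr0//.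
  rewrite /laplacian big1// => i _.
  have -> : partial i (cst 1 : 'rV[R]_N -> R) = cst 0.
    by apply/funext => y; exact: derive_cst.
  exact: derive_cst.
apply/negP; rewrite -ltNge /g laplacian_gaussian -/(g c).
have -> : expR (- al * sqdist z c) = g c by [].
have gc := g_gt0 c.
have LM : M < 4 * al ^+ 2 * sqdist z c - 2 * N%:R * al.
  have : 4 * al ^+ 2 * d < 4 * al ^+ 2 * sqdist z c.
    by rewrite ltr_pM2l// mulr_gt0// exprn_gt0.
  have -> : 4 * al ^+ 2 * d = al * (4 * d * b + 4 * d) by rewrite /al; ring.
  rewrite bE => H.
  have : M <= al * (M + 1) + al * (4 * d).
    have : 0 <= al * (4 * d) by rewrite mulr_ge0 ?ltW// mulr_gt0.
    have : 1 * (M + 1) <= al * (M + 1) by rewrite ler_wpM2r ?addr_ge0// /al; lra.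
    lra.
  lra.
set L := (X in eps * (X * _)); have := Lw c Ac.
move: hc0; rewrite hE => hc0 lw.
have s1 : M * (w c - eps * g c) <= 0.
  by rewrite mulr_ge0_le0//; move: hc0; nra.
have : M * g c < L * g c by rewrite ltr_pM2r.
nra.
Qed.

End StrongMaximumPrinciple.

(** * Propagation of positivity through the exterior of a ball *)

Section ExteriorPositivity.
Context {R : realType} {N : nat}.
Implicit Types (w : 'rV[R]_N -> R) (x y z : 'rV[R]_N).

(** A substitute for the triangle inequality in squared distances, by completing the square in each
    coordinate. *)
Lemma sqdist_young z y (k : R) : 0 < k ->
  (1 - k) * sqdist 0 z - (k^-1 - 1) * sqdist z y <= sqdist 0 y.
Proof.
move=> k0; rewrite /sqdist !mulr_sumr -sumrB; apply: ler_sum => i _; rewrite !mxE !subr0.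
set a := z ord0 i; set b := y ord0 i; rewrite -subr_ge0.
have -> : b ^+ 2 - ((1 - k) * a ^+ 2 - (k^-1 - 1) * (b - a) ^+ 2) =
   (k * a + (b - a)) ^+ 2 / k by field; rewrite gt_eqF.
by rewrite divr_ge0 ?sqr_ge0// ltW.
Qed.

(** The point is that d does not depend on z: balls of one size can follow a whole path. *)
Lemma ball_in_exterior (r m : R) : 0 <= r -> r < m ->
  exists2 d : R, 0 < d & forall z y, m <= sqdist 0 z -> sqdist z y <= d ->
    r < sqdist 0 y.
Proof.
(* For this k, (1 - k) m = (m + r) / 2 exceeds r by (m - r) / 2, and the choice of d keeps the
   subtracted term at most (m - r) / 4. *)
move=> r0 rm; pose k := (m - r) / (2 * m).
have m0 : 0 < m by lra.
have k0 : 0 < k by rewrite divr_gt0; lra.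
have km : k * (2 * m) = m - r by rewrite /k divfK// gt_eqF//; lra.
have k1 : k < 1 by rewrite /k ltr_pdivrMr; lra.
exists (k * ((m - r) / 4)); first by rewrite mulr_gt0//; lra.
move=> z y mz zy; apply: lt_le_trans (sqdist_young z y k0).
have h1 : (1 - k) * m <= (1 - k) * sqdist 0 z by rewrite ler_wpM2l//; lra.
have h2 : (k^-1 - 1) * sqdist z y <= (k^-1 - 1) * (k * ((m - r) / 4)).
  by rewrite ler_wpM2l// subr_ge0 invf_ge1// ltW.
have h3 : (k^-1 - 1) * (k * ((m - r) / 4)) = (1 - k) * ((m - r) / 4).
  by field; rewrite gt_eqF.
nra.
Qed.

Definition segment_point x y (s : R) : 'rV[R]_N := (1 - s) *: x + s *: y.

Lemma sqdist_segment x y (s t : R) :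
  sqdist (segment_point x y s) (segment_point x y t) = (t - s) ^+ 2 * sqdist x y.
Proof.
rewrite /sqdist mulr_sumr; apply: eq_bigr => i _; rewrite !mxE; ring.
Qed.

Lemma sqdistZ (t : R) x : sqdist 0 (t *: x) = t ^+ 2 * sqdist 0 x.
Proof. by rewrite /sqdist mulr_sumr; apply: eq_bigr => i _; rewrite !mxE; ring. Qed.

Lemma sqdist0_gt0 x i : x ord0 i != 0 -> 0 < sqdist 0 x.
Proof.
move=> xi; apply: lt_le_trans (sqdist_coord 0 x i).
by rewrite mxE subr0 exprn_even_gt0.
Qed.

Lemma sqdist0_gt0P x : 0 < sqdist 0 x -> exists i, x ord0 i != 0.
Proof.
move=> x0; apply/existsP; apply: contraTT x0; rewrite negb_exists => /forallP h.
rewrite -leNgt /sqdist big1// => i _; have := h i; rewrite negbK => /eqP ->.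
by rewrite mxE subrr expr0n.
Qed.

Section Positivity.
Variables (r M : R) (w : 'rV[R]_N -> R).
Hypotheses (r0 : 0 <= r) (M0 : 0 <= M).
Let A := [set x : 'rV[R]_N | r < sqdist 0 x].
Hypotheses (Cw : Ck 2 A w) (w0 : forall x, A x -> 0 <= w x)
  (Lw : forall x, A x -> laplacian w x <= M * w x).

(** The segment is cut into n + 1 equal steps of squared length |x - y|^2 / (n + 1)^2 < d, with d
    the uniform squared radius; each ball passes positivity to the centre of the next. *)
Lemma positive_along_segment (m : R) x y : r < m ->
  (forall s, 0 <= s <= 1 -> m <= sqdist 0 (segment_point x y s)) ->
  0 < w x -> 0 < w y.
Proof.
move=> rm hm wx; have [d d0 dA] := ball_in_exterior r0 rm.
have [n] : exists n : nat, sqdist x y / d < n.+1%:R.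
  by eexists; exact: truncnS_gt.
rewrite ltr_pdivrMr// => nd.
have n0 : 0 < n.+1%:R :> R by rewrite ltr0n.
have step k : (k <= n.+1)%N -> 0 < w (segment_point x y (k%:R / n.+1%:R)).
  elim: k => [_|k IH kn].
    by rewrite mul0r /segment_point subr0 scale1r scale0r addr0.
  have kn' : (k <= n.+1)%N by exact: ltnW.
  apply: (@positive_in_ball _ _ w A _ d M _ _ Cw w0 M0 Lw (IH kn')).
  - exact: open_sqexterior.
  - move=> z /= zd; apply: dA zd; apply: hm; apply/andP; split.
      by rewrite divr_ge0.
    by rewrite ler_pdivrMr// mul1r ler_nat.
  - rewrite sqdist_segment -mulrBl -natr1 addrAC subrr add0r mul1r.
    rewrite exprVn mulrC ltr_pdivrMr ?exprn_gt0//; apply: lt_le_trans nd _.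
    rewrite mulrC ler_pM2l// expr2 ler_peMl ?ler1n ?ler0n//.
have := step n.+1 (leqnn _); rewrite divff ?gt_eqF//.
by rewrite /segment_point subrr scale0r add0r scale1r.
Qed.

Lemma positive_radially (t : R) x : A x -> 1 <= t -> 0 < w x -> 0 < w (t *: x).
Proof.
move=> Ax t1; apply: (positive_along_segment Ax) => s /andP[s0 s1].
have -> : segment_point x (t *: x) s = (1 + s * (t - 1)) *: x.
  by apply/rowP => i; rewrite !mxE; ring.
rewrite sqdistZ ler_peMl ?sqdist_ge0// exprn_ege1// lerDl mulr_ge0//; lra.
Qed.

Lemma positive_radially_inv (t : R) x : A x -> 1 <= t -> 0 < w (t *: x) -> 0 < w x.
Proof.
move=> Ax t1; apply: (positive_along_segment Ax) => s /andP[s0 s1].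
have -> : segment_point (t *: x) x s = (1 + (1 - s) * (t - 1)) *: x.
  by apply/rowP => i; rewrite !mxE; ring.
rewrite sqdistZ ler_peMl ?sqdist_ge0// exprn_ege1// lerDl mulr_ge0//; lra.
Qed.

(** A segment avoiding the origin has a positive minimal squared norm m. Scaled by t it stays
    outside the ball once t^2 m > r, which t >= 1 + r / m guarantees. *)
Lemma positive_along_far_segment x y :
  (forall s, 0 <= s <= 1 -> 0 < sqdist 0 (segment_point x y s)) ->
  exists2 T : R, 1 <= T & forall t, T <= t -> 0 < w (t *: x) -> 0 < w (t *: y).
Proof.
move=> hs.
have c : continuous (fun s : R => sqdist 0 (segment_point x y s)).
  move=> s; apply: (@continuous_comp _ _ _ (segment_point x y)); last exact: continuous_sqdist.
  apply: continuousD; last exact: scalel_continuous.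
  apply: (@continuous_comp _ _ _ (fun s : R => 1 - s) (fun k : R => k *: x)).
    by apply: continuousB; [exact: cst_continuous|exact: cvg_id].
  exact: scalel_continuous.
have [c0 c01 cmin] := EVT_min ler01 (continuous_subspaceT c).
set m := sqdist 0 (segment_point x y c0) in cmin.
have m0 : 0 < m by apply: hs; move: c01; rewrite in_itv.
exists (1 + r / m); first by rewrite lerDl divr_ge0// ltW.
move=> t Tt; have t0 : 1 <= t by rewrite (le_trans _ Tt)// lerDl divr_ge0// ltW.
have rm : r < t ^+ 2 * m.
  rewrite -ltr_pdivrMr//; apply: (@lt_le_trans _ _ t).
    by apply: lt_le_trans Tt; rewrite ltrDr.
  by rewrite expr2 ler_peMl//; lra.
apply: (positive_along_segment rm) => s s01.
have -> : segment_point (t *: x) (t *: y) s = t *: segment_point x y s.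
  by apply/rowP => i; rewrite !mxE; ring.
by rewrite sqdistZ ler_pM2l ?exprn_gt0//; [apply: cmin; rewrite in_itv|lra].
Qed.

(* The path goes out radially, moves to a far point of a coordinate axis
   transversal to both ends (one exists as N >= 3), and comes back. *)
Lemma positive_in_exterior x y : (3 <= N)%N -> A x -> A y -> 0 < w x -> 0 < w y.
Proof.
move=> N3 Ax Ay wx.
have [i xi] : exists i, x ord0 i != 0 by apply: sqdist0_gt0P; exact: le_lt_trans Ax.
have [k yk] : exists i, y ord0 i != 0 by apply: sqdist0_gt0P; exact: le_lt_trans Ay.
have [j] : exists j : 'I_N, (j != i) && (j != k).
  apply/existsP; rewrite -[[exists _, _]]negbK negb_exists; apply/negP => /forallP h.
  have : (#|[set: 'I_N]%SET| <= #|[set i; k]%SET|)%N.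
    apply: subset_leq_card; apply/fintype.subsetP => l _; rewrite !inE.
    by have := h l; rewrite negb_and !negbK.
  rewrite cardsT card_ord cards2 => h2; have := leq_trans N3 h2.
  by case: (i != k).
move=> /andP[ji jk]; pose e : 'rV[R]_N := delta_mx ord0 j.
have ej : e ord0 j != 0 by rewrite mxE !eqxx oner_eq0.
(* The l-th coordinate of the point is (1 - s) z_l, which vanishes only at s = 1, where the point is
   e. *)
have off z l s : z ord0 l != 0 -> j != l -> 0 < sqdist 0 (segment_point z e s).
  move=> zl jl; have [->|s1] := eqVneq s 1.
    by rewrite /segment_point subrr scale0r add0r scale1r; exact: sqdist0_gt0 ej.
  apply: (@sqdist0_gt0 _ l).
  rewrite !mxE eqxx/= [l == j]eq_sym (negbTE jl) mulr0 addr0.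
  by rewrite mulf_neq0// subr_eq0 eq_sym.
have [T1 T11 h1] := positive_along_far_segment (fun s _ => off x i s xi ji).
have [T2 T21 h2] : exists2 T : R, 1 <= T &
    forall t, T <= t -> 0 < w (t *: e) -> 0 < w (t *: y).
  apply: positive_along_far_segment => s _.
  have -> : segment_point e y s = segment_point y e (1 - s).
    by rewrite /segment_point opprB addrC addrCA subrr addr0 addrC.
  exact: off yk jk.
pose t := Num.max T1 T2.
have t1 : 1 <= t by rewrite le_max T11.
apply: (positive_radially_inv Ay t1); apply: h2; first by rewrite le_max lexx orbT.
by apply: h1; [rewrite le_max lexx|exact: positive_radially].
Qed.

End Positivity.
End ExteriorPositivity.

(** * Instability *)

Section TestFunction.
Context {R : realType} {N : nat}.
Implicit Types (x : 'rV[R]_N).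

Lemma sqr_enorm x : enorm x ^+ 2 = sqdist 0 x.
Proof.
rewrite /enorm sqr_sqrtr; first by apply: eq_bigr => i _; rewrite mxE subr0.
by apply: sumr_ge0 => i _; exact: sqr_ge0.
Qed.

Lemma enorm_ge0 x : 0 <= enorm x. Proof. exact: sqrtr_ge0. Qed.

Lemma lt_enorm (r : R) x : 0 <= r -> (r < enorm x) = (r ^+ 2 < sqdist 0 x).
Proof. by move=> r0; rewrite -sqr_enorm ltr_pXn2r// nnegrE ?enorm_ge0. Qed.

Lemma not_ecballP (r : R) x : 0 <= r -> ~ ecball N r x <-> r ^+ 2 < sqdist 0 x.
Proof.
move=> r0; rewrite -lt_enorm// ltNge; split => [h|/negP//].
by apply/negP.
Qed.

Lemma destabilizing_function (r delta : R) : (0 < N)%N -> 0 < delta ->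
  exists phi : 'rV[R]_N -> R,
  [/\ smooth setT phi, (forall x, 0 <= phi x), (exists x, 0 < phi x),
      (exists b1 b2 : R, [/\ r < b1, 0 < b1 &
         forall x, phi x != 0 -> b1 <= sqdist 0 x <= b2]) &
      forall x, 0 < phi x ->
        - (nu_star R N ^+ 2 + delta) * phi x / sqdist 0 x < laplacian phi x].
Proof.
(* The value of a is nonnegative and pushes the shell beyond |x|^2 = r. As lam >= 1, delta lam^2 >=
   delta lam = delta + 512 > 256, so the loss 256 / lam^2 is strictly below delta. *)
move=> N0 d0; pose a := ln (1 + `|r|); pose lam := 1 + 512 / delta.
have r1 : 1 <= 1 + `|r| by rewrite lerDl.
have r10 : 0 < 1 + `|r| by exact: lt_le_trans r1.
have a0 : 0 <= a by exact: ln_ge0.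
have Ea : expR a = 1 + `|r| by rewrite lnK.
have lam1 : 1 <= lam by rewrite lerDl mulr_ge0 ?ler0n ?invr_ge0 ?(ltW d0).
have lam0 : 0 < lam by exact: lt_le_trans lam1.
have q0 x : 0 < radial_bump a lam x -> 0 < sqdist 0 x.
  move=> /radial_bump_gt0P - /(_ lam0) /andP[aq _]; rewrite ltNge; apply/negP => q0.
  by move: aq; rewrite (ln0 q0) ltNge a0.
have phi0 := @radial_bump_ge0 R N a lam.
have pos x : radial_bump a lam x != 0 -> 0 < radial_bump a lam x.
  by move=> h; rewrite lt_neqAle eq_sym h phi0.
exists (radial_bump a lam); split.
- exact: smooth_radial_bump.
- exact: phi0.
(* A point of a coordinate axis at the logarithmic midpoint of the shell. *)
- pose t := Num.sqrt (expR (a + lam / 2)).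
  exists (t *: delta_mx ord0 (Ordinal N0)); apply/radial_bump_gt0P => //.
  rewrite sqdistZ [sqdist 0 _](_ : _ = 1); last first.
    rewrite /sqdist (bigD1 (Ordinal N0))//= big1 ?addr0.
      by rewrite !mxE !eqxx subr0 expr1n.
    by move=> i i0; rewrite !mxE (negbTE i0) subrr expr0n.
  rewrite mulr1 sqr_sqrtr ?expR_ge0// expRK; apply/andP; split; lra.
- exists (1 + `|r|), (expR (a + lam)); split => //.
    by rewrite (le_lt_trans (ler_norm r))// ltrDr.
  move=> x /pos hx; have qx := q0 x hx.
  move/radial_bump_gt0P : hx => /(_ lam0) /andP[h1 h2].
  by rewrite -Ea -(lnK (x := sqdist 0 x))// !ler_expR !ltW.
- move=> x hx; have qx := q0 x hx.
  apply: lt_le_trans (laplacian_radial_bump_ge a lam0 qx).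
  rewrite ltr_pM2r ?invr_gt0// ltr_pM2r// ltrN2 ltrD2l.
  rewrite ltr_pdivrMr ?exprn_gt0//.
  have h : delta * lam = delta + 512 by rewrite /lam mulrDr mulr1 mulrCA divff ?gt_eqF// mulr1.
  have : delta * lam <= delta * lam ^+ 2 by rewrite ler_pM2l// expr2 ler_peMl// ltW.
  by rewrite h; lra.
Qed.

End TestFunction.

(** * Convexity of t^p and the potential at infinity *)

Lemma powR_tangent {R : realType} (p a b : R) : 1 < p -> 0 < a -> a <= b ->
  p * a `^ (p - 1) * (b - a) <= b `^ p - a `^ p.
Proof.
move=> p1 a0; rewrite le_eqVlt => /orP[/eqP <-|ab]; first by rewrite !subrr mulr0.
have [c] : exists2 c, c \in `]a, b[%R & b `^ p - a `^ p = p * c `^ (p - 1) * (b - a).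
  apply: (@MVT R (fun c => c `^ p) (fun c => p * c `^ (p - 1))) => // [c|].
    by rewrite in_itv/= => /andP[ac _]; apply: is_derive1_powR; exact: lt_trans ac.
  apply: derivable_within_continuous => c; rewrite in_itv/= => /andP[ac _].
  by have [] := is_derive1_powR p (lt_le_trans a0 ac).
rewrite in_itv/= => /andP[ac cb] ->; rewrite ler_pM2r ?subr_gt0//.
rewrite ler_pM2l; last lra.
by apply: ge0_ler_powR; rewrite ?nnegrE ?ltW//; lra.
Qed.

Lemma asymptotic_potential {R : realType} {N : nat} (p nu C : R) (U : 'rV[R]_N -> R) :
  1 < p -> 0 < C -> nu ^+ 2 < p * C `^ (p - 1) ->
  (C%:E <= limf_einf (fun x => (U x / enorm x `^ (- (2 / (p - 1))))%:E)
             (enorm_infty R N))%E ->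
  exists r delta : R, [/\ 0 < r, 0 < delta & forall x, r < enorm x ->
    (nu ^+ 2 + delta) / sqdist 0 x <= p * U x `^ (p - 1)].
Proof.
(* D is halfway between nu^2 and p C^(p-1), and C' below solves p C'^(p-1) = D. Hence C' < C, so U
   exceeds C' |x|^(- 2 / (p - 1)) far out, and D - nu^2 serves as delta. *)
move=> p1 C0 hC hinf; pose D := (p * C `^ (p - 1) + nu ^+ 2) / 2.
have p0 : 0 < p by exact: lt_trans p1.
have p10 : 0 < p - 1 by rewrite subr_gt0.
have D0 : nu ^+ 2 < D by rewrite /D; lra.
have Dgt0 : 0 < D by apply: le_lt_trans D0; exact: sqr_ge0.
pose C' := (D / p) `^ (p - 1)^-1.
have C'p : C' `^ (p - 1) = D / p.
  by rewrite /C' -powRrM mulVf ?gt_eqF// powRr1// divr_ge0// ltW.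
have C'0 : 0 < C' by rewrite powR_gt0// divr_gt0.
have C'C : C' < C.
  rewrite ltNge; apply/negP => CC'.
  have := ge0_ler_powR (ltW p10) (ltW C0) (ltW C'0) CC'.
  rewrite C'p ler_pdivlMr// mulrC leNgt => /negP; apply; rewrite /D; lra.
have : (C'%:E < limf_einf (fun x => (U x / enorm x `^ (- (2 / (p - 1))))%:E)
             (enorm_infty R N))%E by apply: lt_le_trans hinf; rewrite lte_fin.
rewrite limf_einfE => /ereal_sup_gt[_ [V VF <-] C'V].
have [r [rr rV]] := VF.
pose r1 := Num.max r 0 + 1.
exists r1, (D - nu ^+ 2); split.
- by rewrite ltr_wpDl// le_max lexx orbT.
- by rewrite subr_gt0.
move=> x xr; rewrite addrC subrK.
have x0 : 0 < enorm x by apply: lt_trans xr; rewrite ltr_wpDl// le_max lexx orbT.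
have Vx : V x.
  apply: (rV r1) => //; rewrite (@le_lt_trans _ _ (Num.max r 0))// ?le_max ?lexx//.
  by rewrite ltrDl.
have : C' < U x / enorm x `^ (- (2 / (p - 1))).
  rewrite -lte_fin; apply: (lt_le_trans C'V); apply: ereal_inf_lbound.
  by exists x.
rewrite ltr_pdivlMr ?powR_gt0// => /ltW h.
have h0 : 0 <= C' * enorm x `^ (- (2 / (p - 1))) by rewrite mulr_ge0 ?powR_ge0 ?ltW.
have := ge0_ler_powR (ltW p10) h0 (le_trans h0 h) h.
rewrite (powRM _ (ltW C'0) (powR_ge0 _ _)) C'p -powRrM mulNr divfK ?gt_eqF//.
rewrite powRN (powR_mulrn _ (enorm_ge0 x)) sqr_enorm => H.
by rewrite [p * _]mulrC -ler_pdivrMr// mulrAC.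
Qed.

Section Instability.
Context {R : realType} {N : nat}.
Implicit Types (U u w phi : 'rV[R]_N -> R) (x : 'rV[R]_N).

Lemma Cc_shell phi (b1 b2 : R) : continuous phi ->
  (forall x, phi x != 0 -> b1 <= sqdist 0 x <= b2) -> Cc phi.
Proof.
move=> cphi hb; split => //; exists (Num.max b2 0 + 1).
  by rewrite addr_ge0// le_max lexx orbT.
move=> x i xi; apply: contrapT => /eqP /hb /andP[_ qb2].
have := le_trans (sqdist_coord 0 x i) qb2; rewrite mxE subr0.
have b2m : b2 <= Num.max b2 0 by rewrite le_max lexx.
have m0 : 0 <= Num.max b2 0 by rewrite le_max lexx orbT.
rewrite -real_normK ?num_real//; set t := `|_| in xi *; nra.
Qed.

(** Admits factors such as |x|^-2 or U^(p-1), whose continuity is known only away from the origin or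
    the core; closer in, the product is identically 0. *)
Lemma CcM_away_from_origin phi h (b : R) : Cc phi ->
  (forall x, sqdist 0 x < b -> phi x = 0) ->
  (forall x, b <= sqdist 0 x -> {for x, continuous h}) -> Cc (phi \* h).
Proof.
move=> [cphi [B B0 phiB]] phib ch; split; last first.
  by exists B => // x i xi /=; rewrite (phiB _ _ xi) mul0r.
move=> x; have [xb|xb] := ltP (sqdist 0 x) b; last first.
  by apply: continuousM; [exact: cphi|exact: ch].
have E : {in [set y : 'rV[R]_N | sqdist 0 y < b], cst 0 =1 phi \* h}.
  by move=> y; rewrite inE /= => /phib ->; rewrite mul0r.
by apply: (for_continuous_eq (@open_sqball R N 0 b) E xb); apply: cst_continuous.
Qed.

(** By parts, the quadratic form at [phi] is minus the integral of f = phi (Laplacian phi + V phi),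
    which is nonnegative and positive wherever phi is. *)
Lemma not_stable (p nu delta r r1 : R) U : (0 < N)%N -> 1 < p -> 0 < delta ->
  0 < r -> 0 <= r1 ->
  (forall x, r < enorm x -> {for x, continuous U} /\ 0 < U x) ->
  (forall x, r1 < enorm x ->
     (nu ^+ 2 + delta) / sqdist 0 x <= p * U x `^ (p - 1)) ->
  ~ stable p nu U (~` ecball N r).
Proof.
move=> N0 p1 d0 r0 r10 hU hV hs; have d20 : 0 < delta / 2 by rewrite divr_gt0.
(* The radius argument bounds |x|^2, and r^2 + r1^2 dominates both squares. *)
have [phi [sphi phi0 [x0 phix0] [b1 [b2 [rb1 b10 phib]]] Lphi]] :=
  destabilizing_function (r ^+ 2 + r1 ^+ 2) N0 d20.
have far x : b1 <= sqdist 0 x -> [/\ r < enorm x, r1 < enorm x & 0 < sqdist 0 x].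
  move=> bx; have r20 := sqr_ge0 r; have r120 := sqr_ge0 r1.
  by split; rewrite ?lt_enorm// ?ltW//; lra.
have cphi : continuous phi by move=> x; exact: (Ck_continuous (sphi 0)).
have Ccphi := Cc_shell cphi phib.
have phi_in x : sqdist 0 x < b1 -> phi x = 0.
  by move=> xb; apply: contrapT => /eqP /phib /andP[]; rewrite leNgt xb.
have suppS : closure [set x | phi x != 0] `<=` [set x | b1 <= sqdist 0 x <= b2].
  have -> : [set x : 'rV[R]_N | b1 <= sqdist 0 x <= b2] =
      [set x | b1 <= sqdist 0 x] `&` [set x | sqdist 0 x <= b2].
    by apply/seteqP; split => x /=; [move/andP|move=> [-> ->]].
  have cl : closed ([set x : 'rV[R]_N | b1 <= sqdist 0 x] `&` [set x | sqdist 0 x <= b2]).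
    apply: closedI.
      by have /continuous_closedP/(_ _ (@closed_ge R b1)) := @continuous_sqdist R N 0.
    by have /continuous_closedP/(_ _ (@closed_le R b2)) := @continuous_sqdist R N 0.
  move/closure_id : (cl) => ->; apply: closure_subset => x /= /phib /andP[].
  by split.
have test : test_function (~` ecball N r) phi.
  split => //.
    apply: subclosed_compact (@compact_sqball R N 0 b2) _; first exact: closed_closure.
    by move=> x /suppS /= /andP[].
  move=> x /suppS /= /andP[/far[rx _ _] _]; apply/not_ecballP; first exact: ltW.
  by rewrite -lt_enorm// ltW.
have := hs phi test.
set c := nu ^+ 2 - nu_star R N ^+ 2.
have Ck2 : Ck 2 setT phi := sphi 2.
rewrite (integral_grad_sqr Ck2 Ccphi).
have g1E : Cc (laplacian phi).
  by apply: Cc_sum => i; apply: Cc_partial; [exact: CkS_partial|apply: Cc_partial => //; exact: CkW].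
pose g1 := phi \* laplacian phi.
pose g2 := fun x => phi x ^+ 2 / enorm x ^+ 2.
pose g3 := fun x => U x `^ (p - 1) * phi x ^+ 2.
have Cg1 : Cc g1 by apply: CcM => //; case: g1E.
have Cg2 : Cc g2.
  have -> : g2 = (phi \* (fun x => (sqdist 0 x)^-1)) \* phi.
    by apply/funext => x; rewrite /g2 sqr_enorm expr2 mulrAC.
  apply: CcM => //; apply: (CcM_away_from_origin Ccphi phi_in) => x /far[_ _ qx].
  apply: continuousV; first by rewrite gt_eqF.
  exact: continuous_sqdist.
have Cg3 : Cc g3.
  have -> : g3 = (phi \* (fun x => U x `^ (p - 1))) \* phi.
    by apply/funext => x; rewrite /g3 /= expr2 mulrA; congr (_ * _); exact: mulrC.
  apply: CcM => //; apply: (CcM_away_from_origin Ccphi phi_in) => x /far[/hU[cU Ux] _ _].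
  apply: (@continuous_comp _ _ _ U (fun s => s `^ (p - 1))) => //.
  have [D _] := is_derive1_powR (p - 1) Ux.
  exact/differentiable_continuous/derivable1_diffP.
rewrite -/g1 -/g2 -/g3.
pose f := (g1 \+ (fun x => - c * g2 x)) \+ (fun x => p * g3 x).
have Cf : Cc f by apply: CcD; [apply: CcD => //|]; exact: CcZ.
have : integral_rV f = integral_rV g1 + - c * integral_rV g2 + p * integral_rV g3.
  rewrite /f (integral_rVD (CcD Cg1 (CcZ (- c) Cg2)) (CcZ p Cg3)).
  by rewrite (integral_rVD Cg1 (CcZ (- c) Cg2)) (integral_rVZ (- c) Cg2) (integral_rVZ p Cg3).
have fx x : 0 < phi x -> 0 < f x.
  move=> phix; have /andP[/far[rx r1x qx] _] := phib x (lt0r_neq0 phix).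
  have -> : f x = phi x * (laplacian phi x +
      (p * U x `^ (p - 1) - c / sqdist 0 x) * phi x).
    by rewrite /f /g1 /g2 /g3 /= sqr_enorm; ring.
  rewrite mulr_gt0//.
  have h1 := Lphi x phix; have h2 := hV x r1x.
  have h3 : (nu_star R N ^+ 2 + delta) / sqdist 0 x <=
      p * U x `^ (p - 1) - c / sqdist 0 x.
    rewrite lerBrDr -mulrDl (_ : _ + c = nu ^+ 2 + delta)//; rewrite /c; ring.
  have h4 : (nu_star R N ^+ 2 + delta) / sqdist 0 x * phi x <=
      (p * U x `^ (p - 1) - c / sqdist 0 x) * phi x by rewrite ler_pM2r.
  have h5 : 0 < delta / 2 * phi x / sqdist 0 x by rewrite !mulr_gt0// invr_gt0.
  have h6 : (nu_star R N ^+ 2 + delta) / sqdist 0 x * phi x =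
    (nu_star R N ^+ 2 + delta / 2) * phi x / sqdist 0 x +
    delta / 2 * phi x / sqdist 0 x by field; rewrite gt_eqF.
  lra.
have f0 x : 0 <= f x.
  have := phi0 x; rewrite le_eqVlt => /orP[/eqP px|/fx /ltW//].
  by rewrite /f /g1 /g2 /g3 /= -px expr0n/= !mul0r !mulr0 !addr0.
have := integral_rV_gt0 Cf f0 (fx _ phix0); lra.
Qed.

(* At a maximum of phi / w the function (phi / w)(max) w - phi has a minimum,
   which contradicts the differential inequalities. *)
Lemma no_positive_supersolution (delta r r1 : R) (V : 'rV[R]_N -> R) w : (0 < N)%N ->
  0 < delta -> 0 <= r -> 0 <= r1 ->
  let A := [set x : 'rV[R]_N | r < sqdist 0 x] in
  Ck 2 A w -> (forall x, A x -> 0 < w x) ->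
  (forall x, A x -> laplacian w x + V x * w x <= 0) ->
  (forall x, r1 < sqdist 0 x -> (nu_star R N ^+ 2 + delta) / sqdist 0 x <= V x) ->
  False.
Proof.
move=> N0 d0 r0 r10 A Cw wpos Lw hV.
(* In this lemma r and r1 already bound squared norms, so they are added without squaring. *)
have [phi [sphi phi0 [x0 phix0] [b1 [b2 [rb1 b10 phib]]] Lphi]] :=
  destabilizing_function (r + r1) N0 d0.
have oA : open A by exact: open_sqexterior.
pose S := [set x : 'rV[R]_N | b1 <= sqdist 0 x <= b2].
have SA : S `<=` A by move=> x /= /andP[bx _]; rewrite /A /=; lra.
have Sx0 : S x0 by apply: phib; exact: lt0r_neq0.
have cS : compact S.
  apply: subclosed_compact (@compact_sqball R N 0 b2) _; last by move=> x /= /andP[].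
  have -> : S = [set x | b1 <= sqdist 0 x] `&` [set x | sqdist 0 x <= b2].
    by apply/seteqP; split => x /=; [move/andP|move=> [? ?]; apply/andP].
  apply: closedI.
    by have /continuous_closedP/(_ _ (@closed_ge R b1)) := @continuous_sqdist R N 0.
  by have /continuous_closedP/(_ _ (@closed_le R b2)) := @continuous_sqdist R N 0.
have cphi : continuous phi by move=> x; exact: (Ck_continuous (sphi 0)).
have [c] : exists2 c, c \in S & forall t, t \in S -> phi t / w t <= phi c / w c.
  apply: EVT_max_rV; [by exists x0|by []|].
  apply/continuous_in_subspaceT => y; rewrite inE => /SA Ay.
  have cV : {for y, continuous (fun t => (w t)^-1)}.
    by apply: continuousV; [rewrite gt_eqF ?wpos|exact: (Ck_continuous Cw Ay)].
  exact: (continuousM (cphi y) cV).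
rewrite inE => Sc cmax; have Ac := SA _ Sc; have wc := wpos _ Ac.
set m := phi c / w c in cmax.
have m0 : 0 < m.
  apply: lt_le_trans (cmax x0 _); last by rewrite inE.
  by rewrite divr_gt0// wpos//; exact: SA.
have phic : phi c = m * w c by rewrite /m divfK// gt_eqF.
have phic0 : 0 < phi c by rewrite phic mulr_gt0.
have Cphi : Ck 2 A phi by apply: Ck_sub (sphi 2).
pose h := fun x => m * w x + -1 * phi x.
have Ch : Ck 2 A h := CkD oA (CkZ m oA Cw) (CkZ (-1) oA Cphi).
have : 0 <= laplacian h c.
  apply: (laplacian_min_ge0 oA Ch Ac) => y Ay.
  rewrite /h phic !mulN1r subrr subr_ge0.
  have [->|/eqP/phib Sy] := pselect (phi y = 0); first by rewrite mulr_ge0 ?ltW// wpos.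
  by rewrite -ler_pdivrMr ?wpos// cmax// inE.
rewrite (laplacian_linear m (-1) oA Cw Cphi Ac).
have qc : r1 < sqdist 0 c by move: Sc => /= /andP[? _]; lra.
have h1 := Lphi c phic0; have h2 := hV c qc; have h3 := Lw c Ac.
have q0 : 0 < sqdist 0 c by exact: le_lt_trans qc.
have h4 : (nu_star R N ^+ 2 + delta) / sqdist 0 c * phi c <= V c * phi c by rewrite ler_pM2r.
have h5 : m * (laplacian w c + V c * w c) <= 0 by rewrite mulr_ge0_le0// ltW.
have h6 : m * (laplacian w c + V c * w c) = m * laplacian w c + V c * phi c.
  by rewrite phic; ring.
have h7 : - (nu_star R N ^+ 2 + delta) * phi c / sqdist 0 c =
  - ((nu_star R N ^+ 2 + delta) / sqdist 0 c * phi c) by ring.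
lra.
Qed.

End Instability.

Theorem theorem4p3 (R : realType) (N : nat) (p nu C : R) (K : set 'rV[R]_N)
    (U : 'rV[R]_N -> R)
    (hN : (3 <= N)%N) (hp : p_S R N < p) (hnu : 0 < nu)
    (* C is the constant C_{p,nu}: the unique positive number with this
       (p-1)-th power *)
    (hC : 0 < C)
    (hCpnu : C `^ (p - 1) = nu ^+ 2 - (nu_star R N - 2 / (p - 1)) ^+ 2)
    (hpC : nu ^+ 2 < p * C `^ (p - 1))
    (hK : admissible_core K)
    (hUpos : forall x, ~ K x -> 0 < U x)
    (hUsub : subsolution p nu K U)
    (hUinf : (C%:E <= limf_einf
                (fun x => (U x / enorm x `^ (- (2 / (p - 1))))%:E)
                (enorm_infty R N))%E) :
  unstable p nu K U /\
  (forall u : 'rV[R]_N -> R,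
     (forall x, ~ K x -> 0 < u x) ->
     supersolution p nu K u ->
     (* Both alternatives are taken in the exterior of the ball of radius r,
        for every such r containing K, so in particular for arbitrarily
        large r. *)
     forall r : R, 0 < r -> K `<=` ecball N r ->
       (forall x, ~ ecball N r x -> u x = U x) \/
       (exists x, ~ ecball N r x /\ (u \- U)^\- x != 0)).
Proof.
have N0 : (0 < N)%N by exact: leq_trans hN.
have N2 : 0 < N%:R - 2 :> R by rewrite subr_gt0 ltr_nat.
have p1 : 1 < p by apply: le_lt_trans hp; rewrite /p_S ler_pdivlMr//; lra.
have [r1 [delta [r10 d0 hV]]] := asymptotic_potential p1 hC hpC hUinf.
have [CU LU] := hUsub.
split.
  move=> [r [r0 Kr st]].
  apply: (not_stable N0 p1 d0 r0 (ltW r10) _ hV st) => x rx.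
  have nKx : ~ K x.
    by move=> /Kr; apply/not_ecballP; rewrite ?ltW// -lt_enorm// ltW.
  by split; [exact: (Ck_continuous CU)|exact: hUpos].
move=> u upos [Cu Lu] r r0 Kr.
(* When the second alternative fails, u >= U throughout the exterior of the ball. *)
have [|nex] := pselect (exists x, ~ ecball N r x /\ (u \- U)^\- x != 0); first by right.
left; pose A := [set x : 'rV[R]_N | r ^+ 2 < sqdist 0 x].
have AE x : ~ ecball N r x <-> A x by apply: not_ecballP; exact: ltW.
have AK : A `<=` ~` K by move=> x /AE h /Kr.
have oA : open A by exact: open_sqexterior.
pose w := u \- U.
have w0 x : A x -> 0 <= w x.
  move=> /AE nx; rewrite leNgt; apply/negP => wx; apply: nex; exists x; split => //.
  by rewrite /funrneg gt_eqF// lt_max oppr_gt0 wx.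
have CAU := Ck_sub AK CU; have CAu := Ck_sub AK Cu.
have Cw : Ck 2 A w by exact: CkB.
set c := nu ^+ 2 - nu_star R N ^+ 2 in LU Lu.
pose V x := p * U x `^ (p - 1) - c / sqdist 0 x.
have Lw x : A x -> laplacian w x + V x * w x <= 0.
  move=> Ax; have nK := AK _ Ax; have h1 := LU x nK; have h2 := Lu x nK.
  move: h1 h2; rewrite /hardy_op -/c sqr_enorm => h1 h2.
  have Uu : U x <= u x by have := w0 x Ax; rewrite /w /= subr_ge0.
  have h3 := powR_tangent p1 (hUpos x nK) Uu.
  have -> : laplacian w x = laplacian u x - laplacian U x.
    have -> : w = (fun y => 1 * u y + -1 * U y).
      by apply/funext => y; rewrite mul1r mulN1r.
    by rewrite (laplacian_linear 1 (-1) oA CAu CAU Ax) mul1r mulN1r.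
  have -> : V x * w x = p * U x `^ (p - 1) * (u x - U x) -
      (c / sqdist 0 x * u x - c / sqdist 0 x * U x) by rewrite /V /w /=; ring.
  lra.
pose M := `|c| / r ^+ 2.
have r20 : 0 < r ^+ 2 by rewrite exprn_gt0.
have M0 : 0 <= M by rewrite divr_ge0 ?normr_ge0 ?(ltW r20).
have LwM x : A x -> laplacian w x <= M * w x.
  move=> Ax; have wx := w0 x Ax; have qx : 0 < sqdist 0 x by exact: lt_trans Ax.
  have h1 : 0 <= p * U x `^ (p - 1) by rewrite mulr_ge0 ?powR_ge0//; lra.
  have h2 : c / sqdist 0 x <= M.
    rewrite /M (le_trans (ler_norm _))// normrM ler_wpM2l// ger0_norm ?invr_ge0 ?(ltW qx)//.
    by rewrite lef_pV2 ?posrE// ltW.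
  have h3 : 0 <= (M + V x) * w x by rewrite mulr_ge0// /V; lra.
  have := Lw x Ax; rewrite mulrDl in h3; lra.
have [[x0 [Ax0 wx0]]|nw] := pselect (exists x, A x /\ 0 < w x); last first.
  move=> x /AE Ax; apply/eqP; rewrite -subr_eq0; apply/eqP/le_anti.
  rewrite (w0 x Ax) andbT leNgt; apply/negP => wx; apply: nw.
  by exists x.
exfalso.
have wpos x : A x -> 0 < w x.
  by move=> Ax; exact: (positive_in_exterior (ltW r20) M0 Cw w0 LwM hN Ax0 Ax wx0).
apply: (no_positive_supersolution (V := V) N0 d0 (ltW r20) (sqr_ge0 r1) Cw wpos Lw).
move=> x; rewrite -lt_enorm ?(ltW r10)// => /hV h.
rewrite /V lerBrDr -mulrDl (_ : _ + c = nu ^+ 2 + delta)//; rewrite /c; ring.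
Qed.
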